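(* Let $(W,S)$ be a finitely generated Coxeter group, let $R$ be a commutative ring with unit, and let $q\in R$ be such that the Poincaré polynomial value $p_{(W_I,I)}(q)$ is invertible in $R$ for every $I\subseteq S$ for which the parabolic subgroup $W_I$ is finite (spherical). Let $\mathcal{H}=\mathcal{H}_q(W,S)$ be the $R$-Hecke algebra associated with $(W,S)$ and parameter $q$, let $\mathcal{B}=\{T_w\mid w\in W\}$, and let $\varepsilon_q$ be the index representation. Then $(\mathcal{H},\mathcal{B},\varepsilon_q)$ is an $R$-Euler algebra. Moreover, $$\chi_{(\mathcal{H},\mathcal{B},\varepsilon_q)}=(p_{(W,S)}(q))^{-1}\in R,$$ and, if $(W,S)$ is not spherical (i.e. $W$ is infinite), then $$\chi_{(\mathcal{H},\mathcal{B},\varepsilon_q)}=\sum_{I\subsetneq S}(-1)^{|S\setminus I|-1}\,\chi_{(\mathcal{H}_I,\mathcal{B}\cap\mathcal{H}_I,\varepsilon_q)},$$ where $\varepsilon_q$ also denotes the restriction of $\varepsilon_q$ to $\mathcal{H}_I$. In particular, if $R=\mathbb{Z}[[q]]$ (formal power series in the indeterminate $q$, with $q$ as parameter), then $\chi_{(\mathcal{H},\mathcal{B},\varepsilon_q)}=p_{(W,S)}(q)^{-1}$.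
   Context: Coxeter groups. $(W,S)$ is a Coxeter system with $S=\{s_i\}$ finite (possibly empty): $W$ is generated by the involutions in $S$ subject to the relations $(s_is_j)^{m_{i,j}}=1$ for $i\neq j$ with $m_{i,j}\in\{2,3,\dots\}\cup\{\infty\}$ (no relation if $m_{i,j}=\infty$). $\ell\colon W\to\mathbb{N}_0$ is the length function. For $I\subseteq S$, $W_I$ is the subgroup generated by $I$; $(W_I,I)$ is a Coxeter group whose length function is the restriction of $\ell$. ''Spherical'' means finite. Poincaré series. $p_{(W,S)}(t)=\sum_{w\in W}t^{\ell(w)}\in\mathbb{Z}[[t]]$, a polynomial if $W$ is finite. It is a rational function, and for $W$ infinite it satisfies $\frac{1}{p_{(W,S)}(t)}=\sum_{I\subsetneq S}(-1)^{|S|-|I|-1}\frac{1}{p_{(W_I,I)}(t)}$. Applying this recursively, $1/p_{(W,S)}(t)$ is a $\mathbb{Z}$-linear combination of the functions $1/p_{(W_I,I)}(t)$ with $W_I$ finite; hence it lies in the localization of $\mathbb{Z}[t]$ at the multiplicative set generated by the polynomials $p_{(W_I,I)}(t)$ with $W_I$ finite, and $(p_{(W,S)}(q))^{-1}\in R$ denotes its image under the ring homomorphism from this localization to $R$ sending $t\mapsto q$. (For $R=\mathbb{Z}[[q]]$ this is the inverse of the power series $p_{(W,S)}(q)$.) Hecke algebras. For a commutative ring $R$ and $q\in R$, the $R$-Hecke algebra $\mathcal{H}=\mathcal{H}_q(W,S)$ is the unique associative unital $R$-algebra which is a free $R$-module with basis $\{T_w\mid w\in W\}$ (with unit $T_1$)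 subject to, for $s\in S$, $w\in W$: $T_sT_w=T_{sw}$ if $\ell(sw)>\ell(w)$, and $T_sT_w=(q-1)T_w+qT_{sw}$ if $\ell(sw)<\ell(w)$. The index representation $\varepsilon_q\colon\mathcal{H}\to R$ is the $R$-algebra homomorphism with $\varepsilon_q(T_w)=q^{\ell(w)}$. For $I\subseteq S$, $\mathcal{H}_I$ is the $R$-subalgebra generated by $\{T_s\mid s\in I\}$; it is the $R$-span of $\mathcal{B}\cap\mathcal{H}_I=\{T_w\mid w\in W_I\}$, with $\mathcal{H}_\emptyset=R$. Hattori–Stallings rank. For an associative unital $R$-algebra $\mathbf{A}$ let $[\mathbf{A},\mathbf{A}]$ be the $R$-span of all $ab-ba$, and $\underline{\mathbf{A}}=\mathbf{A}/[\mathbf{A},\mathbf{A}]$. For a finitely generated projective left $\mathbf{A}$-module $P$, with $P^*=\mathrm{Hom}_{\mathbf{A}}(P,\mathbf{A})$, let $\gamma_P\colon P^*\otimes_{\mathbf{A}}P\to\mathrm{End}_{\mathbf{A}}(P)$ be the isomorphism $\gamma_P(p^*\otimes p)(x)=p^*(x)p$, and $\mathrm{ev}_P(p^*\otimes p)=p^*(p)+[\mathbf{A},\mathbf{A}]$. The Hattori–Stallings rank of $P$ is $r_P=\mathrm{ev}_P(\gamma_P^{-1}(\mathrm{id}_P))\in\underline{\mathbf{A}}$. A left $\mathbf{A}$-module $M$ is of type FP if it has a resolution $P_\bullet\to M$ of finite length by finitely generated projective left $\mathbf{A}$-modules; its Hattori–Stallings rank is $r_M=\sum_k(-1)^kr_{P_k}\in\underline{\mathbf{A}}$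 (independent of the resolution). Euler algebras. An $R$-Euler algebra is a triple $(\mathbf{A},\mathcal{B},\lambda)$ where $\mathbf{A}$ is an associative $R$-algebra, $\mathcal{B}\subseteq\mathbf{A}$ is a free $R$-basis containing $1$, and $\lambda\colon\mathbf{A}\to R$ is an $R$-algebra homomorphism, such that (i) the left $\mathbf{A}$-module $R_\lambda$ (equal to $R$ as $R$-module, with $a.r=\lambda(a)r$) is of type FP, and (ii) the $R$-linear map $\tilde\mu_{\mathcal{B}}\colon\mathbf{A}\to R$ with $\tilde\mu_{\mathcal{B}}(1)=1$ and $\tilde\mu_{\mathcal{B}}(b)=0$ for $b\in\mathcal{B}\setminus\{1\}$ satisfies $\tilde\mu_{\mathcal{B}}(xy)=\tilde\mu_{\mathcal{B}}(yx)$ for all $x,y\in\mathbf{A}$. Let $\mu_{\mathcal{B}}\colon\underline{\mathbf{A}}\to R$ be the map induced by $\tilde\mu_{\mathcal{B}}$. The Euler characteristic is $\chi_{(\mathbf{A},\mathcal{B},\lambda)}=\mu_{\mathcal{B}}(r_{R_\lambda})\in R$. *)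

(* Defs.v *)
From HB Require Import structures.
From mathcomp Require Import all_boot all_order all_algebra.
From mathcomp Require Import generic_quotient ring_quotient finmap.
From mathcomp Require Import boolp classical_sets functions cardinality.

Set Implicit Arguments.
Unset Strict Implicit.
Unset Printing Implicit Defensive.

Import GRing.Theory.

Local Open Scope classical_set_scope.
Local Open Scope ring_scope.

(* [f : fps R] is the series [\sum_n f n * 'X^n]. *)
Definition fps (R : comNzRingType) : Type := nat -> R.

HB.instance Definition _ (R : comNzRingType) := gen_eqMixin (fps R).
HB.instance Definition _ (R : comNzRingType) := gen_choiceMixin (fps R).

Section PowerSeries.
Variable R : comNzRingType.
Implicit Types f g h : fps R.

Definition fps_zero : fps R := fun=> 0.
Definition fps_opp f : fps R := fun n => - f n.
Definition fps_add f g : fps R := fun n => f n + g n.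
Definition fps_of_poly (p : {poly R}) : fps R := fun n => p`_n.
Definition fps_one : fps R := fps_of_poly 1.
Definition fpsX : fps R := fps_of_poly 'X.
Definition fps_mul f g : fps R := fun n => \sum_(i < n.+1) f i * g (n - i)%N.

Lemma fps_addA : associative fps_add.
Proof. by move=> f g h; apply/funext => n; rewrite /fps_add addrA. Qed.

Lemma fps_addC : commutative fps_add.
Proof. by move=> f g; apply/funext => n; rewrite /fps_add addrC. Qed.

Lemma fps_add0 : left_id fps_zero fps_add.
Proof. by move=> f; apply/funext => n; rewrite /fps_add add0r. Qed.

Lemma fps_addN : left_inverse fps_zero fps_opp fps_add.
Proof. by move=> f; apply/funext => n; rewrite /fps_add addNr. Qed.

HB.instance Definition _ :=
  GRing.isZmodule.Build (fps R) fps_addA fps_addC fps_add0 fps_addN.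

Let trunc (N : nat) f : {poly R} := \poly_(i < N) f i.

Let fps_mul_trunc N f g n : (n < N)%N ->
  fps_mul f g n = (trunc N f * trunc N g)`_n.
Proof.
move=> ltnN; rewrite coefM; apply: eq_bigr => i _.
rewrite !coef_poly (leq_ltn_trans (leq_subr i n) ltnN).
by rewrite (leq_trans (ltn_ord i) ltnN).
Qed.

Lemma fps_mulC : commutative fps_mul.
Proof.
by move=> f g; apply/funext => n; rewrite !(fps_mul_trunc _ _ (ltnSn n)) mulrC.
Qed.

Lemma fps_mulA : associative fps_mul.
Proof.
move=> f g h; apply/funext => n.
transitivity ((trunc n.+1 f * (trunc n.+1 g * trunc n.+1 h))`_n).
  rewrite coefM; apply: eq_bigr => i _.
  rewrite coef_poly ltn_ord (@fps_mul_trunc n.+1) //.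
  by rewrite ltnS leq_subr.
rewrite mulrA coefM; apply: eq_bigr => i _.
by rewrite -fps_mul_trunc // coef_poly ltnS leq_subr.
Qed.

Lemma fps_mul1 : left_id fps_one fps_mul.
Proof.
move=> f; apply/funext => n.
rewrite /fps_mul /fps_one /fps_of_poly big_ord_recl /= coef1 mul1r subn0 big1.
  by rewrite addr0.
by move=> i _; rewrite coef1 mul0r.
Qed.

Lemma fps_mulDl : left_distributive fps_mul fps_add.
Proof.
move=> f g h; apply/funext => n; rewrite /fps_mul /fps_add -big_split /=.
by apply: eq_bigr => i _; rewrite mulrDl.
Qed.

Lemma fps_one_neq0 : fps_one != 0 :> fps R.
Proof.
apply/eqP => /(congr1 (fun f : fps R => f 0%N)).
rewrite /fps_one /fps_of_poly coef1 => /eqP.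
exact/negP/(oner_neq0 R).
Qed.

HB.instance Definition _ := GRing.Zmodule_isComNzRing.Build (fps R)
  fps_mulA fps_mulC fps_mul1 fps_mulDl fps_one_neq0.

End PowerSeries.

Section Coxeter.
Variables (W : groupType) (S : finType).
Implicit Types (m : S -> S -> option nat) (s : S -> W) (I : {set S}).

Definition is_subgroup (K : set W) : Prop :=
  [/\ K 1%g, forall x y, K x -> K y -> K (x * y)%g
    & forall x, K x -> K (x^-1)%g].

Definition generated_subgroup (X : set W) : set W :=
  [set w | forall K, is_subgroup K -> X `<=` K -> K w].

(* [m i j = None] stands for [m_ij = oo]; the diagonal of [m] is unused. *)
Definition coxeter_relations m (G : groupType) (f : S -> G) : Prop :=
  (forall i, (f i * f i)%g = 1%g) /\
  (forall i j k, i != j -> m i j = Some k -> ((f i * f j) ^+ k)%g = 1%g).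

(* The presentation of [W] is expressed by its universal property. *)
Record coxeter_system m s : Prop := CoxeterSystem {
  coxeter_sym : forall i j, m i j = m j i;
  coxeter_ge2 : forall i j k, i != j -> m i j = Some k -> (2 <= k)%N;
  coxeter_gen : forall w, generated_subgroup (range s) w;
  coxeter_rel : coxeter_relations m s;
  coxeter_univ : forall (G : groupType) (f : S -> G), coxeter_relations m f ->
    exists phi : {multiplicative W -> G}, forall i, phi (s i) = f i }.

Definition word s (u : seq S) : W := (\prod_(i <- u) s i)%g.

Definition has_word_of_size s (w : W) (n : nat) : bool :=
  `[< exists u, size u = n /\ word s u = w >].

(* The value [0] in the second branch is never used in a Coxeter system, where
   every element is the product of some word in the generators. *)
Definition len s (w : W) : nat :=
  if pselect (exists n, has_word_of_size s w n) is left ex then ex_minn ex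
  else 0%N.

Definition parabolic s I : set W :=
  generated_subgroup (s @` [set i | i \in I]).

Definition spherical s I : Prop := finite_set (parabolic s I).

(* Since the length function of a parabolic subgroup is the restriction of
   that of [W], its Poincare series is [poincare_series s (parabolic s I)];
   for [I] spherical, this is the polynomial [poincare_poly s I]. *)
Definition poincare_series s (X : set W) : fps int :=
  fun n => (#|` fset_set [set w | X w /\ len s w = n]|)%:Z.

Definition poincare_poly s I : {poly int} :=
  \sum_(w <- fset_set (parabolic s I)) 'X^(len s w).

(* Membership in the multiplicative subset of [{poly int}] generated by the
   Poincare polynomials of the spherical parabolic subgroups. *)
Definition spherical_denominator s (d : {poly int}) : Prop :=
  exists r : seq {set S},
    (forall I, I \in r -> spherical s I) /\ d = \prod_(I <- r) poincare_poly s I.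

End Coxeter.

Definition eval_int (R : comNzRingType) (q : R) (p : {poly int}) : R :=
  (map_poly intr p).[q].

Definition invertible (R : comNzRingType) (x : R) : Prop := exists y, x * y = 1.

(* [r] is the image of [1 / p_(W,S)(t)] in [R]: writing this inverse as a
   fraction [n / d] with [d] a spherical denominator, [r = n(q) / d(q)]. *)
Definition poincare_inverse_at (W : groupType) (S : finType) (s : S -> W)
    (R : comNzRingType) (q r : R) : Prop :=
  exists n d : {poly int},
    [/\ spherical_denominator s d,
        poincare_series s setT * fps_of_poly n = fps_of_poly d
      & r * eval_int q d = eval_int q n].

Lemma fps_of_polyM (R : comNzRingType) (p p' : {poly R}) :
  fps_of_poly (p * p') = fps_of_poly p * fps_of_poly p'.
Proof. by apply/funext => n; rewrite /fps_of_poly coefM. Qed.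

Lemma fps_of_poly_inj (R : comNzRingType) : injective (@fps_of_poly R).
Proof.
by move=> p p' eqpp'; apply/polyP => n; apply: (congr1 (fun f => f n) eqpp').
Qed.

Lemma eval_intM (R : comNzRingType) (q : R) (p p' : {poly int}) :
  eval_int q (p * p') = eval_int q p * eval_int q p'.
Proof. by rewrite /eval_int rmorphM hornerM. Qed.

Lemma spherical_denominator_invertible (W : groupType) (S : finType)
    (s : S -> W) (R : comNzRingType) (q : R) (d : {poly int}) :
  (forall I, spherical s I -> invertible (eval_int q (poincare_poly s I))) ->
  spherical_denominator s d -> invertible (eval_int q d).
Proof.
move=> qI [r [rsph ->]]; elim: r rsph => [_|I r IHr rsph].
  by exists 1; rewrite big_nil /eval_int rmorph1 hornerC mulr1.
have [|x xE] := qI I; first by apply: rsph; rewrite mem_head.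
have [J Jr|y yE] := IHr; first by apply: rsph; rewrite in_cons Jr orbT.
by exists (x * y); rewrite big_cons eval_intM mulrACA xE yE mulr1.
Qed.

Lemma poincare_inverse_at_uniq (W : groupType) (S : finType) (s : S -> W)
    (R : comNzRingType) (q r r' : R) :
  (forall I, spherical s I -> invertible (eval_int q (poincare_poly s I))) ->
  poincare_inverse_at s q r -> poincare_inverse_at s q r' -> r = r'.
Proof.
move=> qI [n [d [sd Pn rd]]] [n' [d' [sd' Pn' rd']]].
have {Pn Pn'} nd : n * d' = n' * d.
  by apply: fps_of_poly_inj; rewrite !fps_of_polyM -Pn -Pn' mulrCA [RHS]mulrCA
    [fps_of_poly n * _]mulrC.
have [x dx] := spherical_denominator_invertible qI sd.
have [x' dx'] := spherical_denominator_invertible qI sd'.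
have cancel (a b e y : R) : e * y = 1 -> a * e = b * e -> a = b.
  by move=> ey /(congr1 ( *%R^~ y)); rewrite -!mulrA ey !mulr1.
apply/(cancel _ _ _ _ dx)/(cancel _ _ _ _ dx').
by rewrite rd -eval_intM nd eval_intM -rd' mulrAC.
Qed.

Section Span.
Variables (R : comNzRingType) (V : lmodType R).

Definition lin_span (X : set V) : set V :=
  [set v | exists r : seq (R * V),
     (forall u, u \in r -> X u.2) /\ v = \sum_(u <- r) u.1 *: u.2].

Definition free_basis (B : set V) : Prop :=
  (forall v, lin_span B v) /\
  (forall (r : seq V) (c : V -> R), uniq r -> (forall b, b \in r -> B b) ->
     \sum_(b <- r) c b *: b = 0 -> forall b, b \in r -> c b = 0).

End Span.

Section Subalgebra.
Variables (R : comNzRingType) (A : algType R) (X : set A).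

Definition generated_subalgebra : {pred A} :=
  fun a => `[< forall K : {pred A}, GRing.subalg_closed K ->
                 (forall x, X x -> x \in K) -> a \in K >].

Lemma generated_subalgebra_closed : GRing.subalg_closed generated_subalgebra.
Proof.
split=> [|a u v /asboolP uX /asboolP vX|u v /asboolP uX /asboolP vX];
  apply/asboolP => K Kalg KX; case: (Kalg) => K1 KD KM //.
  by apply: KD; [exact: uX|exact: vX].
by apply: KM; [exact: uX|exact: vX].
Qed.

HB.instance Definition _ := GRing.isSubalgClosed.Build R A generated_subalgebra
  generated_subalgebra_closed.

Record subalgebra : Type := Subalgebra {
  subalgebra_val :> A; _ : subalgebra_val \in generated_subalgebra }.

HB.instance Definition _ := [isSub for subalgebra_val].
HB.instance Definition _ := [Choice of subalgebra by <:].
HB.instance Definition _ := [SubChoice_isSubAlgebra of subalgebra by <:].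

Definition subalgebra_restr (lam : {lrmorphism A -> R | *%R}) : subalgebra -> R :=
  lam \o \val.

HB.instance Definition _ (lam : {lrmorphism A -> R | *%R}) :=
  GRing.RMorphism.copy (subalgebra_restr lam) (lam \o \val).
HB.instance Definition _ (lam : {lrmorphism A -> R | *%R}) :=
  GRing.Linear.copy (subalgebra_restr lam) (lam \o \val).

End Subalgebra.

Definition finitely_generated (A : pzRingType) (P : lmodType A) : Prop :=
  exists (n : nat) (g : 'I_n -> P),
    forall x, exists a : 'I_n -> A, x = \sum_(i < n) a i *: g i.

Definition projective (A : pzRingType) (P : lmodType A) : Prop :=
  forall (M N : lmodType A) (f : {linear M -> N}) (g : {linear P -> N}),
    (forall y, exists x, f x = y) ->
    exists h : {linear P -> M}, forall x, f (h x) = g x.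

(* A finite resolution is extended by zero modules above its length. *)
Record fp_resolution (A : pzRingType) (M : lmodType A) := FPResolution {
  res_len : nat;
  res_mod : nat -> lmodType A;
  res_diff : forall k, {linear res_mod k.+1 -> res_mod k};
  res_aug : {linear res_mod 0 -> M};
  res_fg : forall k, finitely_generated (res_mod k);
  res_proj : forall k, projective (res_mod k);
  res_bounded : forall k, (res_len < k)%N -> forall x : res_mod k, x = 0;
  res_aug_surj : forall y, exists x, res_aug x = y;
  res_exact0 : forall x, res_aug x = 0 <-> exists y, res_diff 0 y = x;
  res_exact : forall k x, res_diff k x = 0 <-> exists y, res_diff k.+1 y = x }.

Definition type_FP (A : pzRingType) (M : lmodType A) : Prop :=
  inhabited (fp_resolution M).

Section HattoriStallings.
Variables (R : comNzRingType) (A : algType R).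

Definition commutator_span : {pred A} :=
  fun a => `[< lin_span [set z | exists x y : A, z = x * y - y * x] a >].

Lemma commutator_span_closed : zmod_closed commutator_span.
Proof.
split; first by apply/asboolP; exists [::]; split=> //; rewrite big_nil.
move=> u v /asboolP[r [rX ->]] /asboolP[t [tX ->]]; apply/asboolP.
exists (r ++ [seq (- w.1, w.2) | w <- t]); split.
  move=> w; rewrite mem_cat => /orP[/rX//|/mapP[w' w't ->]].
  exact: (tX _ w't).
rewrite big_cat big_map -sumrN /=; congr (_ + _).
by apply: eq_bigr => w _; rewrite scaleNr.
Qed.

HB.instance Definition _ :=
  GRing.isZmodClosed.Build A commutator_span commutator_span_closed.

Definition abelianization : zmodType := Quotient.quot commutator_span.

Section Rank.
Variable P : lmodType A.

(* The list of the pairs [(f_i, p_i)] represents the element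
   [\sum_i f_i ⊗ p_i] of the tensor product of [P^*] and [P] over [A]. *)
Definition hs_gamma (t : seq ({linear P -> A^o} * P)) (x : P) : P :=
  \sum_(u <- t) (u.1 x : A) *: u.2.

Definition hs_ev (t : seq ({linear P -> A^o} * P)) : abelianization :=
  (\pi_abelianization (\sum_(u <- t) (u.1 u.2 : A)))%qT.

(* For [P] finitely generated projective, [hs_gamma] is bijective on the tensor
   product, so that any two such [t] represent the same tensor; [hs_ev] respects
   the tensor relations. *)
Definition hs_rank_proj : abelianization :=
  xget 0 [set r | exists t, (forall x, hs_gamma t x = x) /\ r = hs_ev t].

End Rank.

(* The value does not depend on the resolution. *)
Definition hs_rank (M : lmodType A) : abelianization :=
  xget 0 [set r | exists Q : fp_resolution M,
    r = \sum_(k < (res_len Q).+1) hs_rank_proj (res_mod Q k) *~ (-1) ^+ k].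

End HattoriStallings.

Section EulerAlgebra.
Variables (R : comNzRingType) (A : algType R).

Definition index_module (lam : {lrmorphism A -> R | *%R}) : Type := R.

Section IndexModule.
Variable lam : {lrmorphism A -> R | *%R}.

HB.instance Definition _ := GRing.Zmodule.copy (index_module lam) R.

Definition index_scale (a : A) (r : index_module lam) : index_module lam :=
  lam a * (r : R).

Lemma index_scaleA a b r :
  index_scale a (index_scale b r) = index_scale (a * b) r.
Proof. by rewrite /index_scale rmorphM mulrA. Qed.

Lemma index_scale1 : left_id 1 index_scale.
Proof. by move=> r; rewrite /index_scale rmorph1 mul1r. Qed.

Lemma index_scaleDr : right_distributive index_scale +%R.
Proof. by move=> a r r'; rewrite /index_scale mulrDr. Qed.

Lemma index_scaleDl r : {morph index_scale^~ r : a b / a + b}.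
Proof. by move=> a b; rewrite /index_scale rmorphD mulrDl. Qed.

HB.instance Definition _ :=
  GRing.Zmodule_isLmodule.Build A (index_module lam)
    index_scaleA index_scale1 index_scaleDr index_scaleDl.

End IndexModule.

Variables (B : set A) (lam : {lrmorphism A -> R | *%R}).

(* The conditions determine this map when [B] is a basis containing [1]. *)
Definition euler_trace : A -> R :=
  xget (fun=> 0) [set f : A -> R |
    [/\ scalar f, f 1 = 1 & forall b, B b -> b != 1 -> f b = 0]].

Record is_euler_algebra : Prop := IsEulerAlgebra {
  euler_basis : free_basis B;
  euler_basis1 : B 1;
  euler_FP : type_FP (index_module lam);
  euler_traceC : forall x y, euler_trace (x * y) = euler_trace (y * x) }.

(* In an Euler algebra [euler_trace] is constant on the classes modulo
   [commutator_span], hence the choice of [repr x] does not matter. *)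
Definition euler_mu (x : abelianization A) : R := euler_trace (repr x).

Definition euler_char : R := euler_mu (hs_rank (index_module lam)).

End EulerAlgebra.

Section Hecke.
Variables (W : groupType) (S : finType) (s : S -> W).
Variables (R : comNzRingType) (q : R) (H : algType R) (T : W -> H).

Record is_hecke_algebra : Prop := IsHeckeAlgebra {
  hecke_inj : injective T;
  hecke_basis : free_basis (range T);
  hecke_one : T 1%g = 1;
  hecke_up : forall i w, (len s w < len s (s i * w)%g)%N ->
    T (s i) * T w = T (s i * w)%g;
  hecke_down : forall i w, (len s (s i * w)%g < len s w)%N ->
    T (s i) * T w = (q - 1) *: T w + q *: T (s i * w)%g }.

Definition is_index_rep (eps : {lrmorphism H -> R | *%R}) : Prop :=
  forall w, eps (T w) = q ^+ len s w.

Definition hecke_parabolic (I : {set S}) : algType R :=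
  subalgebra [set T (s i) | i in [set i | i \in I]].

Definition hecke_parabolic_basis (I : {set S}) : set (hecke_parabolic I) :=
  [set x | range T (val x)].

Definition hecke_parabolic_rep (eps : {lrmorphism H -> R | *%R}) (I : {set S}) :
    {lrmorphism hecke_parabolic I -> R | *%R} :=
  @subalgebra_restr R H _ eps.

End Hecke.

Arguments hecke_parabolic {W S} s {R H} T I.
Arguments hecke_parabolic_basis {W S} s {R H} T I _.
Arguments hecke_parabolic_rep {W S} s {R H} T eps I.

(* Main.v *)
(* The right descent set of [w] is [{i | len (w s_i) < len w}].  If it contains
   [J], then [len (w u) = len w - len u] for every [u] in [W_J]; in particular
   [W_J] is finite.  In the algebra [A = H_I] let
   [P_J = {a | a T_i = - a for i in J}], an intersection of left ideals [P_i].
   The elements [b_w = \sum_u (-q)^(len u) T_(wu)], with [u] running over [W_J]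
   for [J] the descent set of [w], form an [R]-basis of [A] which is
   unitriangular with respect to [T], and each [P_J] is spanned by the [b_w]
   whose descent set contains [J].  Hence the Koszul-like complex with terms
   [\bigoplus_(#|J| = k) P_J], whose differential is the signed sum of the
   inclusions, splits over the [b_w] into contractible cubes and is a resolution
   of the index module.  It is finite and projective: [P_J = 0] if [W_J] is
   infinite, and otherwise [P_J = A e_J] for an idempotent [e_J] with trace
   [q^N_J / p_J(q)], where [N_J] is the maximal length in [W_J].  Therefore
   [chi_I = \sum_J (-1)^#|J| q^N_J / p_J(q)], the sum being over the spherical
   [J] contained in [I].  The recursion over the proper [I] is Moebius inversion,
   and [chi_S] inverts the Poincare series because every coset of [W_J] contains
   exactly one [w] having [J] among its descents, whence
   [p_W(t) t^N_J = p_J(t) \sum_(w | J <= descents w) t^(len w)]. *)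

From HB Require Import structures.
From mathcomp Require Import all_boot all_order all_algebra.
From mathcomp Require Import generic_quotient ring_quotient finmap.
From mathcomp Require Import boolp classical_sets functions cardinality.
From mathcomp Require Import zify.
Require Import Defs.

Set Implicit Arguments.
Unset Strict Implicit.
Unset Printing Implicit Defensive.

Import GRing.Theory.
Local Open Scope ring_scope.

(** * Koszul signs *)

Section Koszul.
Variables (R : comNzRingType) (S : finType) (V : lmodType R).
Implicit Types (i j : S) (J K : {set S}) (x : {set S} -> V).

(** The usual sign for inserting [i] into [K], with [S] ordered by [enum_rank]. *)
Definition koszul_sign i K : R :=
  (-1) ^+ #|[set j in K | (enum_rank j < enum_rank i)%N]|.

Lemma koszul_sign2 i K : koszul_sign i K * koszul_sign i K = 1.
Proof. by rewrite -expr2 sqrr_sign. Qed.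

Lemma koszul_signU i j K : j \notin K ->
  koszul_sign i (j |: K) = (-1) ^+ (enum_rank j < enum_rank i)%N * koszul_sign i K.
Proof.
move=> jK; rewrite /koszul_sign -exprD; congr (_ ^+ _).
case lt_ji: (enum_rank j < enum_rank i)%N.
  rewrite (_ : [set _ in _ | _] = j |: [set k in K | (enum_rank k < enum_rank i)%N]).
    by rewrite cardsU1 inE (negPf jK).
  by apply/finset.setP => k; rewrite !inE; case: eqP => // ->; rewrite lt_ji.
rewrite add0n; apply: eq_card => k; rewrite !inE.
by case: eqP => [->|]; rewrite ?lt_ji ?andbF.
Qed.

(** Exactly one of [i] and [j] precedes the other, so exactly one of the two signs changes under
    insertion. This is the sign rule behind [d d = 0]. *)
Lemma koszul_sign_swap i j K : i \notin K -> j \notin K -> i != j ->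
  koszul_sign i (j |: K) * koszul_sign j K = - (koszul_sign i K * koszul_sign j (i |:
    K)).
Proof.
move=> iK jK ij; rewrite !koszul_signU //.
have [lt_ij|] := ltnP (enum_rank i) (enum_rank j).
  by rewrite ltnNge ltnW //= expr0 expr1 mulN1r mul1r mulrN opprK.
rewrite leq_eqVlt => /orP[/eqP/val_inj/enum_rank_inj E|lt_ji].
  by rewrite E eqxx in ij.
by rewrite lt_ji expr0 expr1 mulN1r mul1r mulNr.
Qed.

(** Acts on families over all subsets at once, with no grading; the complex of [H_I] is cut out
    later by restricting the support to subsets of one cardinality and the values to [P_J]. *)
Definition koszul_diff x K : V := \sum_(i | i \notin K) koszul_sign i K *: x (i |: K).

Lemma koszul_diffK x K : koszul_diff (koszul_diff x) K = 0.
Proof.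
pose F i j := (koszul_sign i K * koszul_sign j (i |: K)) *: x (j |: (i |: K)).
have -> : koszul_diff (koszul_diff x) K =
    \sum_i \sum_(j | [&& i \notin K, j \notin K & i != j]) F i j.
  rewrite /koszul_diff big_mkcond; apply: eq_bigr => i _.
  have [iK|iK] := boolP (i \in K); first by rewrite /= big_pred0.
  rewrite scaler_sumr; apply: eq_big => [j|j _]; last by rewrite scalerA.
  by rewrite in_setU1 negb_or andbC eq_sym.
(* Pairs [(i, j)] with [i] before [j] are matched with the swapped pairs, whose terms are
   opposite. *)
rewrite pair_big_dep /= (bigID (fun p => enum_rank p.1 < enum_rank p.2)%N) /=.
rewrite [X in _ + X](reindex (fun p : S * S => (p.2, p.1))) /=; last first.
  by exists (fun p => (p.2, p.1)) => -[].
apply/eqP; rewrite addr_eq0; apply/eqP; rewrite -sumrN;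
  apply: eq_big => [[i j]|[i j]] /=.
  have [->|ij] := eqVneq i j; first by rewrite !andbF.
  rewrite /= !andbT [in RHS](andbC (j \notin K)); congr (_ && _).
  rewrite -leqNgt [in RHS]leq_eqVlt; case: eqP => // E.
  by rewrite (enum_rank_inj (val_inj E)) eqxx in ij.
move=> /andP[/and3P[iK jK ij] _]; rewrite /F finset.setUCA -scaleNr; congr (_ *: _).
by rewrite [koszul_sign j K * _]mulrC koszul_sign_swap // opprK.
Qed.

Variable rho : S -> {linear V -> V}.

(** The map [rho i] carries the value at [J :\ i] into the slot [J]. In the application it is a
    projection from [P_(J :\ i)] into [P_J]. *)
Definition koszul_homotopy x J : V :=
  \sum_(i in J) koszul_sign i (J :\ i) *: rho i (x (J :\ i)).

(** The mixed terms, with [i] outside [K] inserted and [j] in [K] removed, occur in both composites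
    with opposite signs. The terms with [i = j] remain: those outside [K] from the first composite,
    those in [K] from the second. *)
Lemma koszul_homotopyP x K :
  koszul_diff (koszul_homotopy x) K + koszul_homotopy (koszul_diff x) K =
  \sum_i rho i (x K).
Proof.
pose F i j := (koszul_sign i (K :\ j) * koszul_sign j (K :\ j)) *: rho j (x (i |: (K
  :\ j))).
have -> : koszul_diff (koszul_homotopy x) K =
    \sum_(i | i \notin K) rho i (x K) - \sum_(i | i \notin K) \sum_(j in K) F i j.
  rewrite -sumrB; apply: eq_bigr => i iK.
  rewrite /koszul_homotopy (big_setU1 _ iK) /= finset.setU1K // scalerDr scalerA
    koszul_sign2 scale1r.
  congr (_ + _); rewrite scaler_sumr -sumrN; apply: eq_bigr => j jK.
  have ij : i != j by apply: contraNneq iK => ->.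
  have E : (i |: K) :\ j = i |: (K :\ j).
    by apply/finset.setP => k; rewrite !inE; case: (eqVneq k i) => [->|];
      rewrite ?ij ?orbT.
  rewrite scalerA E -scaleNr; congr (_ *: _).
  have iKj : i \notin K :\ j by rewrite !inE negb_and iK orbT.
  have jKj : j \notin K :\ j by rewrite !inE eqxx.
  rewrite -{1}(finset.setD1K jK) -[LHS]mulr1 -(koszul_sign2 j (K :\ j)) mulrACA
    koszul_sign_swap //.
  by rewrite mulNr -mulrA [X in _ * X]mulrA koszul_sign2 mul1r.
have -> : koszul_homotopy (koszul_diff x) K =
    \sum_(i in K) rho i (x K) + \sum_(i | i \notin K) \sum_(j in K) F i j.
  rewrite exchange_big -big_split; apply: eq_bigr => j jK /=.
  rewrite /koszul_diff (bigD1 j) /=; last by rewrite !inE eqxx.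
  rewrite linearD scalerDr linearZ scalerA koszul_sign2 scale1r finset.setD1K //;
    congr (_ + _).
  rewrite linear_sum scaler_sumr; apply: eq_big => [i|i _].
    rewrite !inE negb_and negbK; case: (eqVneq i j) => [->|] /=; first by rewrite jK.
    by rewrite andbT.
  by rewrite linearZ scalerA mulrC.
by rewrite addrACA addNr addr0 [RHS](bigID (mem K)) addrC.
Qed.

End Koszul.

Local Open Scope classical_set_scope.
Local Open Scope ring_scope.

(** * Coxeter groups *)

Section TwistedProduct.
Variable W : groupType.
Local Open Scope group_scope.

(* The semidirect product of the [F_2]-valued functions on [W] with [W].  Sending
   [s i] to the pair of the indicator of [s i] and [s i] extends to [W], and the
   first component of the image of [w] is the set of inversions of [w]. *)
Definition twisted : Type := ((W -> bool) * W)%type.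

HB.instance Definition _ := gen_eqMixin twisted.
HB.instance Definition _ := gen_choiceMixin twisted.

Implicit Types a b c : twisted.

Definition twisted_mul a b : twisted :=
  (fun t => a.1 (b.2 * t * b.2^-1) (+) b.1 t, a.2 * b.2).
Definition twisted_one : twisted := (xpred0, 1).
Definition twisted_inv a : twisted := (fun t => a.1 (a.2^-1 * t * a.2), a.2^-1).

Let twisted_eq a b : a.1 =1 b.1 -> a.2 = b.2 -> a = b.
Proof. by case: a b => [f x] [g y] /= /funext-> ->. Qed.

Lemma twisted_mulA : associative twisted_mul.
Proof.
move=> a b c; apply: twisted_eq => [t|] /=; last by rewrite mulgA.
by rewrite addbA invgM !mulgA.
Qed.

Lemma twisted_mul1 : left_id twisted_one twisted_mul.
Proof. by move=> a; apply: twisted_eq => [t|] //=; rewrite mul1g. Qed.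

Lemma twisted_1mul : right_id twisted_one twisted_mul.
Proof.
move=> a; apply: twisted_eq => [t|] /=; last by rewrite mulg1.
by rewrite mul1g invg1 mulg1 addbF.
Qed.

Lemma twisted_mulV : left_inverse twisted_one twisted_inv twisted_mul.
Proof.
move=> a; apply: twisted_eq => [t|] /=; last by rewrite mulVg.
by rewrite !mulgA mulVg mul1g mulgVK addbb.
Qed.

Lemma twisted_Vmul : right_inverse twisted_one twisted_inv twisted_mul.
Proof.
move=> a; apply: twisted_eq => [t|] /=; last by rewrite mulgV.
by rewrite invgK addbb.
Qed.

HB.instance Definition _ := isGroup.Build twisted
  twisted_mulA twisted_mul1 twisted_1mul twisted_mulV twisted_Vmul.

Lemma twisted_mulE a b :
  a * b = (fun t => a.1 (b.2 * t * b.2^-1) (+) b.1 t, a.2 * b.2) :> twisted.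
Proof. by []. Qed.

(** In the dihedral group generated by two involutions, conjugation by [y] inverts [x * y]. *)
Lemma expg_mul_involutionsV (x y : W) n : x * x = 1 -> y * y = 1 ->
  ((x * y) ^+ n)^-1 * y = y * (x * y) ^+ n.
Proof.
move=> xx yy; elim: n => [|n IHn]; first by rewrite expg0 invg1 mul1g mulg1.
have invxy : (x * y)^-1 = y * x.
  by apply: mulg1_eq; rewrite mulgA -(mulgA x) yy mulg1.
by rewrite expgSr invgM -mulgA IHn invxy -expgSr expgS !mulgA.
Qed.

(** The elements [y (x y)^n] with [n < 2k] are the reflections met by the alternating word of length
    [2k]; the first component keeps the parity of their multiplicities. *)
Lemma twisted_pow (x y : W) k (a : twisted := (xpred1 x, x))
    (b : twisted := (xpred1 y, y)) : x * x = 1 -> y * y = 1 ->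
  (a * b : twisted) ^+ k = (fun t => odd (count (fun n => t == y * (x * y) ^+ n)
                                  (iota 0 (k + k))), (x * y) ^+ k) :> twisted.
Proof.
move=> xx yy; have Vx : x^-1 = x by apply: mulg1_eq.
have Vy : y^-1 = y by apply: mulg1_eq.
elim: k => [|k IHk]; first by rewrite !expg0.
have -> : iota 0 (k.+1 + k.+1) = iota 0 (k + k) ++ [:: (k + k)%N; (k + k).+1].
  by rewrite addnS addSn -addn2 iotaD add0n.
rewrite expgS {}IHk !twisted_mulE expgS; congr (_, _); apply/funext => t /=.
rewrite count_cat /= addn0 !oddD !oddb addbC; congr (_ (+) _).
set c := (x * y) ^+ k.
have cV : c^-1 * y = y * c by exact: expg_mul_involutionsV.
have conjE u : (c * t * c^-1 == u) = (t == c^-1 * u * c).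
  by apply/eqP/eqP => [<-|->]; rewrite !mulgA ?mulVg ?mulgV ?mul1g ?mulgVK ?mulgK.
rewrite addbC.
have -> : (y * (c * t * c^-1) * y^-1 == x) = (c * t * c^-1 == y * x * y).
  by apply/eqP/eqP => [<-|->]; rewrite Vy !mulgA ?yy ?mul1g -!mulgA ?yy ?mulg1.
(* The extra factor [a * b] contributes the conjugates of [y] and [y x y] by [c], which are the
   entries [2k] and [2k + 1] of the list. *)
have e1 : c^-1 * y * c = y * (x * y) ^+ (k + k) by rewrite cV -mulgA expgnDr.
have e2 : c^-1 * (y * x * y) * c = y * (x * y) ^+ (k + k).+1.
  rewrite -(mulgA y x y) (mulgA c^-1 y (x * y)) cV -[y * c * _]mulgA -mulgA.
  by rewrite -expgSr -expgnDr addSn.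
by rewrite !conjE e1 e2.
Qed.

End TwistedProduct.

(** * Inversions, strong exchange and descents *)

Section Inversions.
Variables (W : groupType) (S : finType) (m : S -> S -> option nat) (s : S -> W).
Hypothesis hW : coxeter_system m s.
Local Open Scope group_scope.

Lemma simpleK i : s i * s i = 1.
Proof. by case: (coxeter_rel hW). Qed.

Lemma simpleV i : (s i)^-1 = s i.
Proof. exact/mulg1_eq/simpleK. Qed.

Lemma parabolicT w : parabolic s [set: S]%SET w.
Proof.
move=> K sK KX; apply: (coxeter_gen hW w) => // _ [i _ <-].
by apply: KX; exists i => //=; rewrite inE.
Qed.

(** The universal property is applied to the twisted product, and [N w] is the first component of
    the image of [w]. *)
Lemma inversion_cocycle : exists N : W -> W -> bool,
  (forall i, N (s i) = xpred1 (s i)) /\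
  (forall x y t, N (x * y) t = N x (y * t * y^-1) (+) N y t).
Proof.
have [|phi phis] := coxeter_univ hW (G := twisted W)
    (f := fun i => (xpred1 (s i), s i)).
  split=> [i|i j k ij mij].
    rewrite twisted_mulE /= simpleK; congr (_, _); apply/funext => t.
    rewrite simpleV; suff -> : (s i * t * s i == s i) = (t == s i) by rewrite addbb.
    apply/eqP/eqP => [|->]; last by rewrite simpleK mul1g.
    move=> /(congr1 (fun x => s i * x * s i)) /=.
    by rewrite !mulgA simpleK !mul1g -mulgA simpleK mulg1.
  rewrite twisted_pow ?simpleK //.
  have sk := (coxeter_rel hW).2 i j k ij mij.
  rewrite sk; congr (_, _); apply/funext => t.
  (* Since [s i * s j] has [k]-th power [1], the second half of the list of reflections repeats the
     first, and every multiplicity is even. *)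
  rewrite iotaD count_cat add0n.
  suff -> : iota k k = map (addn k) (iota 0 k).
    rewrite count_map oddD; set c1 := count _ _; set c2 := count _ _.
    suff -> : c1 = c2 by rewrite addbb.
    by apply: eq_count => n /=; rewrite expgnDr sk mul1g.
  by rewrite -iotaDl addn0.
have phi1 : phi 1 = 1 by apply: (mulgI (phi 1)); rewrite -gmulfM !mulg1.
have phiV x : phi x^-1 = (phi x)^-1.
  by apply/esym/mulg1_eq; rewrite -gmulfM mulgV.
(* The second component is a homomorphism fixing the generators, hence the identity; this turns
   multiplicativity of [phi] into the cocycle identity. *)
have phi2 w : (phi w).2 = w.
  apply: (coxeter_gen hW w (K := [set w | (phi w).2 = w])) => [|_ [i _ <-]] /=;
    last by rewrite phis.
  split=> /= [|x y xE yE|x xE]; first by rewrite phi1.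
  - by rewrite gmulfM /= xE yE.
  - by rewrite phiV /= xE.
exists (fun w => (phi w).1); split=> [i|x y t]; first by rewrite phis.
by rewrite gmulfM twisted_mulE /= phi2.
Qed.

Lemma word_cons i u : word s (i :: u) = s i * word s u.
Proof. by rewrite /word big_cons. Qed.

Lemma word_cat u v : word s (u ++ v) = word s u * word s v.
Proof. by rewrite /word big_cat. Qed.

Lemma word_rev u : word s (rev u) = (word s u)^-1.
Proof.
elim: u => [|i u IHu]; first by rewrite /word !big_nil invg1.
by rewrite rev_cons -cats1 word_cat IHu !word_cons invgM simpleV /word big_nil mulg1.
Qed.

Lemma parabolicP (J : {set S}) w :
  parabolic s J w <-> exists2 u, {subset u <= J} & word s u = w.
Proof.
split=> [|[u uJ <-] K [K1 KM KV] KJ]; last first.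
  elim: u uJ => [|i u IHu] uJ; first by rewrite /word big_nil.
  rewrite word_cons; apply: KM; last by apply: IHu => j ju; apply: uJ;
    rewrite inE ju orbT.
  by apply: KJ; exists i => //=; apply: uJ; rewrite mem_head.
move=> /(_ [set w | exists2 u, {subset u <= J} & word s u = w]);
  apply=> [|_ [i /= iJ <-]]; last first.
  by exists [:: i]; [move=> j; rewrite inE => /eqP->|rewrite /word big_seq1].
split=> [|_ _ [u uJ <-] [v vJ <-]|_ [u uJ <-]].
- by exists [::] => //; rewrite /word big_nil.
- exists (u ++ v); last by rewrite word_cat.
  by move=> i; rewrite mem_cat => /orP[/uJ|/vJ].
- by exists (rev u); [move=> i; rewrite mem_rev => /uJ|rewrite word_rev].
Qed.

Lemma parabolic1 (J : {set S}) : parabolic s J 1.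
Proof. by apply/parabolicP; exists [::] => //; rewrite /word big_nil. Qed.

Lemma parabolicM (J : {set S}) x y :
  parabolic s J x -> parabolic s J y -> parabolic s J (x * y).
Proof.
move=> Jx Jy K sK KJ; case: (sK) => _ KM _; apply: KM; [exact: Jx|exact: Jy].
Qed.

Lemma parabolicV (J : {set S}) x : parabolic s J x -> parabolic s J x^-1.
Proof. by move=> Jx K sK KJ; case: (sK) => _ _ KV; apply: KV; apply: Jx. Qed.

Lemma parabolic_simple (J : {set S}) i : i \in J -> parabolic s J (s i).
Proof. by move=> iJ K _; apply; exists i. Qed.

Lemma parabolicS (J K : {set S}) w :
  J \subset K -> parabolic s J w -> parabolic s K w.
Proof.
move=> /fintype.subsetP JK /parabolicP[u uJ <-]; apply/parabolicP; exists u => //.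
by move=> i /uJ/JK.
Qed.

Lemma lenP w : exists2 u, size u = len s w & word s u = w.
Proof.
rewrite /len; case: pselect => [ex|[]].
  by case: ex_minnP => n /asboolP[u [us uw]] _; exists u.
have /parabolicP[u _ uw] := parabolicT w.
by exists (size u); apply/asboolP; exists u.
Qed.

Lemma len_word u : (len s (word s u) <= size u)%N.
Proof.
rewrite /len; case: pselect => // ex; case: ex_minnP => n _; apply.
by apply/asboolP; exists u.
Qed.

Lemma len1 : len s 1 = 0%N.
Proof. by apply/eqP; rewrite -leqn0; have := len_word [::];
  rewrite /word big_nil. Qed.

Lemma len_eq0 w : len s w = 0%N -> w = 1.
Proof.
by move=> l0; have [u] := lenP w; rewrite l0 => /size0nil -> <-;
  rewrite /word big_nil.
Qed.

Lemma lenV w : len s w^-1 = len s w.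
Proof.
suff leV x : (len s x^-1 <= len s x)%N.
  by apply/eqP; rewrite eqn_leq leV -[X in (len s X <= _)%N](invgK w) leV.
by have [u <- <-] := lenP x; rewrite -word_rev -(size_rev u) len_word.
Qed.

Lemma lenM x y : (len s (x * y) <= len s x + len s y)%N.
Proof.
have [u <- <-] := lenP x; have [v <- <-] := lenP y.
by rewrite -word_cat -size_cat len_word.
Qed.

Lemma len_simple_le i : (len s (s i) <= 1)%N.
Proof. by have := len_word [:: i]; rewrite /word big_seq1. Qed.

Definition inversion : W -> W -> bool := projT1 (cid inversion_cocycle).

Lemma inversion_simple i t : inversion (s i) t = (t == s i).
Proof. by rewrite /inversion; case: cid => N [/= -> _]. Qed.

Lemma inversionM x y t :
  inversion (x * y) t = inversion x (y * t * y^-1) (+) inversion y t.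
Proof. by rewrite /inversion; case: cid => N [/= _ ->]. Qed.

Lemma inversion1 t : inversion 1 t = false.
Proof.
by have := inversionM 1 1 t; rewrite !mul1g invg1 mulg1; case: (inversion 1 t).
Qed.

(** One reflection for each letter: the letter conjugated by the suffix after it. Right
    multiplication by this reflection cancels that letter. *)
Fixpoint reflections (u : seq S) : seq W :=
  if u is i :: u' then ((word s u')^-1 * s i * word s u') :: reflections u'
  else [::].

Lemma size_reflections u : size (reflections u) = size u.
Proof. by elim: u => //= i u ->. Qed.

Lemma inversion_word u t :
  inversion (word s u) t = odd (count_mem t (reflections u)).
Proof.
elim: u => [|i u IHu] /=; first by rewrite /word big_nil inversion1.
rewrite word_cons inversionM inversion_simple IHu oddD oddb; congr (_ (+) _).
by apply/eqP/eqP => [<-|<-]; rewrite !mulgA ?mulgVK ?mulVg ?mul1g ?mulgV ?mulgK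
  ?mul1g.
Qed.

Lemma exchange u t : t \in reflections u ->
  exists u', [/\ {subset u' <= u}, (size u').+1 = size u
                & word s u' = word s u * t].
Proof.
elim: u => //= i u IHu; rewrite inE => /orP[/eqP->|/IHu[u' [u'u <- u't]]].
  exists u; split=> //; first by move=> j; rewrite inE orbC => ->.
  by rewrite word_cons !mulgA mulgK simpleK mul1g.
exists (i :: u'); split=> //; last by rewrite !word_cons u't mulgA.
by move=> j; rewrite !inE => /orP[->//|/u'u ->]; rewrite orbT.
Qed.

(** If the reflection [t] of the first letter [i] recurs in the tail [u], then [word u * t] equals
    [s i * word u], while exchange writes it as [u] with one letter removed. *)
Lemma deletion u : ~~ uniq (reflections u) ->
  exists u', [/\ {subset u' <= u}, (size u' < size u)%N & word s u' = word s u].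
Proof.
elim: u => //= i u IHu; rewrite negb_and negbK => /orP[/exchange|/IHu].
  case=> u' [u'u u's u'w]; exists u'; split.
  - by move=> j /u'u; rewrite inE orbC => ->.
  - by rewrite -u's leqW.
  - by rewrite u'w word_cons !mulgA mulgV mul1g.
case=> u' [u'u u's u'w]; exists (i :: u'); split=> //.
- by move=> j; rewrite !inE => /orP[->//|/u'u ->]; rewrite orbT.
- by rewrite !word_cons u'w.
Qed.

(** Deletion stays inside [J] and ends in a word with distinct reflections. These are all inversions
    of [w], so each occurs in the list of every word for [w], and no word over [S] is shorter. Thus
    the length of [W_J] is the restriction of that of [W]. *)
Lemma reduced_word (J : {set S}) w : parabolic s J w ->
  exists u, [/\ {subset u <= J}, size u = len s w, word s u = w
               & uniq (reflections u)].
Proof.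
move=> /parabolicP[u]; have [n] := ubnP (size u).
elim: n u => // n IHn u; rewrite ltnS => un uJ uw.
case uu : (uniq (reflections u)); last first.
  have [u' [u'u u's u'w]] := deletion (negbT uu).
  apply: (IHn u'); first exact: leq_trans un.
    by move=> i /u'u/uJ.
  by rewrite u'w.
exists u; split=> //; apply/eqP; rewrite eqn_leq -{2}uw len_word andbT.
have [v <- vw] := lenP w; rewrite -!size_reflections; apply: uniq_leq_size => // t.
rewrite -has_pred1 has_count => tu.
suff : inversion (word s v) t.
  rewrite inversion_word -has_pred1 has_count; exact: odd_gt0.
rewrite vw -uw inversion_word; move: tu.
by rewrite -has_count has_pred1 => tu; rewrite count_uniq_mem // tu.
Qed.

(** An inversion is the reflection of some letter of a reduced word; cancelling this letter gives a
    shorter word for [w * t]. *)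
Lemma inversion_lt w t : inversion w t -> (len s (w * t) < len s w)%N.
Proof.
have [u [_ us uw uu]] := reduced_word (parabolicT w).
rewrite -{1}uw inversion_word => /odd_gt0; rewrite -has_count has_pred1.
by move=> /exchange[u' [_ u's u'w]]; rewrite -us -u's -uw -u'w ltnS len_word.
Qed.

(** By the cocycle identity [s i] is an inversion of exactly one of [w] and [w * s i], so the
    converse follows from [inversion_lt] at [w * s i]. *)
Lemma inversion_simpleE w i : inversion w (s i) = (len s (w * s i) < len s w)%N.
Proof.
apply/idP/idP => [/inversion_lt//|lt_wi]; apply/negPn/negP => Nwi.
have : inversion (w * s i) (s i).
  by rewrite inversionM simpleV -!mulgA simpleK mulg1 inversion_simple eqxx addbT.
by move=> /inversion_lt; rewrite -mulgA simpleK mulg1 ltnNge ltnW.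
Qed.

Lemma len_simple_ltn w i : (len s w < len s (w * s i))%N = ~~ (len s (w * s i) < len
  s w)%N.
Proof.
rewrite -inversion_simpleE; have := inversion_simpleE (w * s i) i.
rewrite -[w * s i * s i]mulgA simpleK mulg1 => <-.
by rewrite inversionM simpleV -!mulgA simpleK mulg1 inversion_simple eqxx addbT.
Qed.

Lemma len_down w i : (len s (w * s i) < len s w)%N -> len s w = (len s (w * s i)).+1.
Proof.
move=> lt_wi; apply/eqP; rewrite eqn_leq lt_wi andbT.
have := lenM (w * s i) (s i); rewrite -mulgA simpleK mulg1 => /leq_trans; apply.
by rewrite -addn1 leq_add2l len_simple_le.
Qed.

Lemma len_up w i : ~~ (len s (w * s i) < len s w)%N -> len s (w * s i) = (len s w).+1.
Proof.
rewrite -len_simple_ltn => lt_wi; rewrite (len_down (w := w * s i) (i := i)) -?mulgA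
  ?simpleK ?mulg1 //.
Qed.

(* If [y = s_i y'] is reduced, the inversion [s_i] of [w = (w y') y'^-1] is not
   one of [y'^-1], so it comes from [w y'], which strong exchange shortens to
   [w y]. *)
Lemma len_descents (J : {set S}) w y :
  {in J, forall i, len s (w * s i) < len s w}%N -> parabolic s J y ->
  (len s (w * y) + len s y)%N = len s w.
Proof.
move=> Jw /reduced_word[u [uJ us uy _]]; elim: u y uJ us uy => [|i u IHu] y uJ us uy.
  by rewrite -us -uy /word big_nil mulg1 addn0.
have iJ : i \in J by apply: uJ; rewrite mem_head.
set y' := word s u; have yE : y = s i * y' by rewrite -uy word_cons.
have ly : len s y' = size u.
  apply/eqP; rewrite eqn_leq len_word /= -ltnS -[X in (X <= _)%N]/(size (i :: u)).
  rewrite us yE (leq_trans (lenM _ _)) // -[X in (_ <= X)%N]add1n.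
  by rewrite leq_add2r len_simple_le.
have {}IHu : (len s (w * y') + size u)%N = len s w.
  rewrite -ly; apply: IHu => // j ju.
  by apply: uJ; rewrite inE ju orbT.
have := Jw i iJ; rewrite -inversion_simpleE -{1}(mulgK y' w) inversionM.
rewrite [in X in _ (+) X]inversion_simpleE -[y'^-1 * s i]invgK invgM invgK simpleV.
rewrite !lenV -yE -us ly ltnNge leqnSn addbF => /inversion_lt.
rewrite [in X in (X < _)%N]yE invgM simpleV !mulgA mulgK -mulgA -yE => lt_wy.
apply/eqP; rewrite eqn_leq; apply/andP; split;
  first by rewrite -IHu /= addnS -addSn leq_add2r.
by rewrite us -[X in (len s X <= _)%N](mulgK y w) (leq_trans (lenM _ _)) // lenV.
Qed.

Definition descends (J : {set S}) (w : W) : bool :=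
  [forall i in J, (len s (w * s i) < len s w)%N].

Lemma descendsP (J : {set S}) w :
  reflect {in J, forall i, len s (w * s i) < len s w}%N (descends J w).
Proof. exact: forall_inP. Qed.

Lemma finite_ball n : finite_set [set w | (len s w <= n)%N].
Proof.
apply: (@sub_finite_set _ _ (\bigcup_(k < n.+1) range (fun u : k.-tuple S => word s
  u))).
  by move=> w /= wn; have [u us uw] := lenP w; exists (len s w) => //=;
     exists (tcast us (in_tuple u)) => //; rewrite val_tcast.
by apply: bigcup_finite => // k _; apply: finite_image; exact: finite_finset.
Qed.

(** By [len_descents], [W_J] lies in the ball of radius [len s w]. *)
Lemma descends_spherical (J : {set S}) w : descends J w -> spherical s J.
Proof.
move=> /descendsP Jw; apply: sub_finite_set (finite_ball (len s w)) => u Ju /=.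
by rewrite -(len_descents Jw Ju) leq_addl.
Qed.

(** An element of maximal length in the finite coset [z W_J] descends under all of [J]. *)
Lemma coset_descends (J : {set S}) z : spherical s J ->
  exists2 u, parabolic s J u & descends J (z * u).
Proof.
move=> sphJ; have bounded : exists M, forall u, parabolic s J u -> (len s (z * u) <=
  M)%N.
  have /finite_seqP[r rE] := sphJ; exists (\max_(u <- r) len s (z * u)) => u.
  rewrite rE /= => ur; exact: (@leq_bigmax_seq _ r xpredT (fun u => len s (z * u))).
case: bounded => M bounded.
pose P n := `[< exists2 u, parabolic s J u & len s (z * u) = n >].
have exP : exists n, P n by exists (len s z); apply/asboolP; exists 1;
  [exact: parabolic1|rewrite mulg1].
have ubP n : P n -> (n <= M)%N by move=> /asboolP[u Ju <-]; exact: bounded.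
case: (ex_maxnP exP ubP) => n /asboolP[u Ju <-] umax.
exists u => //; apply/descendsP => i iJ; apply/negPn/negP => /len_up E.
have /umax : P (len s (z * u * s i)).
  apply/asboolP; exists (u * s i); last by rewrite mulgA.
  exact: parabolicM Ju (parabolic_simple iJ).
by rewrite E ltnn.
Qed.

(** Applying [len_descents] to [w] and to [w * u] gives two length equations whose sum forces
    [len u = 0]. *)
Lemma coset_descends_uniq (J : {set S}) w u :
  parabolic s J u -> descends J w -> descends J (w * u) -> u = 1.
Proof.
move=> Ju /descendsP Jw /descendsP Jwu.
have := len_descents Jwu (parabolicV Ju).
rewrite mulgK lenV -(len_descents Jw Ju) => E; apply: len_eq0; lia.
Qed.

End Inversions.

(** * Hattori-Stallings ranks *)

Definition mk_linear (A : pzRingType) (U V : lmodType A) (f : U -> V)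
    (lf : linear f) : {linear U -> V} :=
  HB.pack f (GRing.isLinear.Build A U V _ f lf).

Section DualBases.
Variables (R : comNzRingType) (A : algType R).
Implicit Types P Q M N : lmodType A.

Definition dual_basis P (t : seq ({linear P -> A^o} * P)) :=
  forall x, hs_gamma t x = x.

(** A section of the surjection from a free module onto [P] has coordinates that form, with the
    generators, a dual basis. *)
Lemma fg_projective_dual_basis P :
  finitely_generated P -> projective P -> exists t, dual_basis (P := P) t.
Proof.
move=> [n [g gP]] projP.
pose f (x : {ffun 'I_n -> A^o}) : P := \sum_(i < n) (x i : A) *: g i.
have f_lin : linear f.
  move=> a x y; rewrite /f scaler_sumr -big_split; apply: eq_bigr => i _.
  by rewrite !ffunE scalerDl scalerA.
have [|h hP] := projP _ _ (mk_linear f_lin) idfun.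
  by move=> y; have [a ->] := gP y; exists [ffun i => a i]; apply: eq_bigr => i _;
    rewrite ffunE.
have c_lin i : linear (fun x => h x i : A^o) by move=> a x y; rewrite linearP !ffunE.
exists [seq (mk_linear (c_lin i), g i) | i <- enum 'I_n] => x.
by rewrite /hs_gamma big_map big_enum /=; exact: hP.
Qed.

(** The condition concerns the values of [g] rather than surjectivity of [f], so that maps into
    cycles can be lifted through a differential without forming the module of cycles. *)
Lemma dual_basis_lift P t M N (f : {linear M -> N}) (g : {linear P -> N}) :
  dual_basis (P := P) t -> (forall x, exists y, f y = g x) ->
  exists h : {linear P -> M}, forall x, f (h x) = g x.
Proof.
move=> tP fg; pose h x := \sum_(u <- t) (u.1 x : A) *: projT1 (cid (fg u.2)).
have h_lin : linear h.
  move=> a x y; rewrite /h scaler_sumr -big_split; apply: eq_bigr => u _.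
  by rewrite linearP scalerDl scalerA.
exists (mk_linear h_lin) => x; rewrite /= /h linear_sum -[in RHS](tP x) linear_sum.
by apply: eq_bigr => u _; rewrite !linearZ; case: cid => y /= ->.
Qed.

Lemma dual_basis_projective P t : dual_basis (P := P) t -> projective P.
Proof. by move=> tP M N f g fsurj; apply: dual_basis_lift tP _. Qed.

Lemma dual_basis_fg P t : dual_basis (P := P) t -> finitely_generated P.
Proof.
move=> tP; exists (size t), (fun i => (tnth (in_tuple t) i).2) => x.
exists (fun i => (tnth (in_tuple t) i).1 x); rewrite -[LHS]tP /hs_gamma.
by rewrite big_tnth.
Qed.

End DualBases.

(** * Traces of endomorphisms of projective modules *)

Section HattoriStallingsTrace.
Variables (R : comNzRingType) (A : algType R) (V : zmodType).
Variable tau : {additive A -> V}.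
Hypothesis tauC : forall x y, tau (x * y) = tau (y * x).
Implicit Types P Q M N : lmodType A.

Definition hs_trace P (t : seq ({linear P -> A^o} * P)) (f : P -> P) : V :=
  \sum_(u <- t) tau (u.1 (f u.2) : A).

(** Expanding along both dual bases turns each side into the same double sum, up to the order of two
    factors under [tau]. *)
Lemma hs_traceC P Q t t' (f : {linear P -> Q}) (g : {linear Q -> P}) :
  dual_basis (P := P) t -> dual_basis (P := Q) t' ->
  hs_trace t (g \o f) = hs_trace t' (f \o g).
Proof.
move=> tP t'Q; rewrite /hs_trace.
transitivity (\sum_(u <- t) \sum_(v <- t') tau ((v.1 (f u.2) : A) * (u.1 (g v.2) :
  A))).
  apply: eq_bigr => u _; rewrite -raddf_sum /= -{1}(t'Q (f u.2)) /hs_gamma.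
  by rewrite !linear_sum; congr (tau _); apply: eq_bigr => v _; rewrite !linearZ.
rewrite exchange_big /=; apply: eq_bigr => v _.
rewrite -{2}(tP (g v.2)) /hs_gamma !linear_sum raddf_sum; apply: eq_bigr => u _.
by rewrite tauC !linearZ.
Qed.

Lemma hs_traceB P t (f g : P -> P) :
  hs_trace t (fun x => f x - g x) = hs_trace t f - hs_trace t g.
Proof.
by rewrite /hs_trace -sumrB; apply: eq_bigr => u _; rewrite !raddfB.
Qed.

Lemma eq_hs_trace P t (f g : P -> P) : f =1 g -> hs_trace t f = hs_trace t g.
Proof. by move=> fg; apply: eq_bigr => u _; rewrite fg. Qed.

End HattoriStallingsTrace.

(** Dependent choice with a type varying by stage, used to build chain maps and homotopies degree by
    degree; [G] is the invariant that lets the construction go on. *)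
Lemma dependent_choice_nat (X : nat -> Type) (G : forall k, X k -> Prop)
    (E : forall k, X k -> X k.+1 -> Prop) (x0 : X 0%N) :
  G 0%N x0 -> (forall k x, G k x -> exists y, G k.+1 y /\ E k x y) ->
  exists2 f : forall k, X k, f 0%N = x0 & forall k, E k (f k) (f k.+1).
Proof.
move=> G0 step.
pose next k (x : {x | G k x}) : {y | G k.+1 y} :=
  let y := cid (step k _ (projT2 x)) in exist _ (projT1 y) (projT2 y).1.
pose f := nat_rect (fun k => {x | G k x}) (exist _ x0 G0) next.
exists (fun k => projT1 (f k)) => // k /=.
by rewrite /next; case: cid => y [].
Qed.

(** * Comparison of resolutions and independence of the rank *)

Section Resolutions.
Variables (R : comNzRingType) (A : algType R).
Implicit Type M : lmodType A.

(** The augmentation plays the role of the differential out of degree zero, which makes exactness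
    uniform in the degree. *)
Definition res_cycle M (Q : fp_resolution M) k : res_mod Q k -> Prop :=
  if k is k'.+1 return res_mod Q k -> Prop then fun x => res_diff Q k' x = 0
  else fun x => res_aug Q x = 0.

Lemma res_cycleP M (Q : fp_resolution M) k x :
  @res_cycle M Q k x <-> exists y, res_diff Q k y = x.
Proof. by case: k x => [|k] x /=; [exact: res_exact0|exact: res_exact]. Qed.

Lemma res_diffK M (Q : fp_resolution M) k x :
  res_diff Q k (res_diff Q k.+1 x) = 0.
Proof. by apply/res_exact; exists x. Qed.

Lemma res_lift M (Q Q' : fp_resolution M) k l
    (f : {linear res_mod Q k -> res_mod Q' l}) :
  (forall x, res_cycle (f x)) ->
  exists h : {linear res_mod Q k -> res_mod Q' l.+1}, forall x, res_diff Q' l (h x) =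
    f x.
Proof.
move=> fZ; have [t tP] := fg_projective_dual_basis (@res_fg _ _ Q k) (@res_proj _ _ Q
  k).
by apply: dual_basis_lift tP _ => x; apply/res_cycleP.
Qed.

(** Comparison theorem. The invariant is that the map built so far sends boundaries to cycles, as
    the next lift requires. *)
Lemma chain_map_exists M (Q Q' : fp_resolution M) :
  exists F : forall k, {linear res_mod Q k -> res_mod Q' k},
    (forall x, res_aug Q' (F 0%N x) = res_aug Q x) /\
    (forall k x, res_diff Q' k (F k.+1 x) = F k (res_diff Q k x)).
Proof.
have [t tP] := fg_projective_dual_basis (@res_fg _ _ Q 0) (@res_proj _ _ Q 0).
have [F0 F0P] := dual_basis_lift (f := res_aug Q') (g := res_aug Q) tP
  (fun x => res_aug_surj Q' _).
pose G k (f : {linear res_mod Q k -> res_mod Q' k}) :=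
  forall x, res_cycle (f (res_diff Q k x)).
have [||F FE FP] := @dependent_choice_nat _ G
  (fun k f g => forall x, res_diff Q' k (g x) = f (res_diff Q k x)) F0.
- by move=> x /=; rewrite F0P; apply/res_exact0; exists x.
- move=> k f fG; have [h hP] := res_lift (f := f \o res_diff Q k) fG.
  by exists h; split=> // x; rewrite /= hP /= res_diffK linear0.
by exists F; split=> //; rewrite FE.
Qed.

(** The invariant says that [E - h d] in the next degree takes its values in cycles. *)
Lemma null_homotopy_exists M (Q : fp_resolution M)
    (E : forall k, {linear res_mod Q k -> res_mod Q k}) :
  (forall x, res_aug Q (E 0%N x) = 0) ->
  (forall k x, res_diff Q k (E k.+1 x) = E k (res_diff Q k x)) ->
  exists h : forall k, {linear res_mod Q k -> res_mod Q k.+1},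
    (forall x, res_diff Q 0 (h 0%N x) = E 0%N x) /\
    (forall k x, res_diff Q k.+1 (h k.+1 x) = E k.+1 x - h k (res_diff Q k x)).
Proof.
move=> E0 ES; have [h0 h0P] := res_lift (f := E 0%N) E0.
pose G k (h : {linear res_mod Q k -> res_mod Q k.+1}) :=
  forall x, res_diff Q k (E k.+1 x - h (res_diff Q k x)) = 0.
have [||h hE hP] := @dependent_choice_nat _ G (fun k h h' =>
  forall x, res_diff Q k.+1 (h' x) = E k.+1 x - h (res_diff Q k x)) h0.
- by move=> x; rewrite linearB ES h0P subrr.
- move=> k h hG; have [h' h'P] := res_lift (f := E k.+1 \- (h \o res_diff Q k)) hG.
  exists h'; split=> // x.
  by rewrite linearB ES h'P /= res_diffK linear0 subr0 subrr.
by exists h; split=> //; rewrite hE.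
Qed.

Variables (V : zmodType) (tau : {additive A -> V}).
Hypothesis tauC : forall x y, tau (x * y) = tau (y * x).

(** With [E = d h + h d], the trace of [d h] in degree [k] equals that of [h d] in degree [k + 1],
    so the alternating sum telescopes. The surviving term is a trace on the module of degree
    [N + 1], which is zero. *)
Lemma hs_trace_null M (Q : fp_resolution M)
    (t : forall k, seq ({linear res_mod Q k -> A^o} * res_mod Q k))
    (E : forall k, {linear res_mod Q k -> res_mod Q k}) N :
  (forall k, dual_basis (t k)) -> (res_len Q <= N)%N ->
  (forall x, res_aug Q (E 0%N x) = 0) ->
  (forall k x, res_diff Q k (E k.+1 x) = E k (res_diff Q k x)) ->
  \sum_(k < N.+1) hs_trace tau (t k) (E k) *~ (-1) ^+ k = 0.
Proof.
move=> tP leN E0 ES; have [h [h0 hS]] := null_homotopy_exists E0 ES.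
pose a k := hs_trace tau (t k) (res_diff Q k \o h k).
have aE k : a k = hs_trace tau (t k.+1) (h k \o res_diff Q k) by exact: hs_traceC.
suff -> : \sum_(k < N.+1) hs_trace tau (t k) (E k) *~ (-1) ^+ k = a N *~ (-1) ^+ N.
  rewrite aE /hs_trace big1 ?mul0rz // => u _.
  by rewrite (@res_bounded _ _ Q N.+1 _ u.2) /= ?linear0 ?raddf0 // ltnS.
elim: N {leN} => [|N IHN].
  rewrite big_ord_recr big_ord0 /= add0r; congr (_ *~ _).
  by apply: eq_hs_trace => x; rewrite /= h0.
rewrite big_ord_recr /= {}IHN aE.
have -> : hs_trace tau (t N.+1) (E N.+1) =
    a N.+1 + hs_trace tau (t N.+1) (h N \o res_diff Q N).
  apply/eqP; rewrite -subr_eq -hs_traceB; apply/eqP.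
  by apply: eq_hs_trace => x; rewrite /= hS.
by rewrite exprS mulN1r !mulrNz mulrzDl opprD addrCA subrr addr0.
Qed.

(** Comparison maps [F] and [G] both ways have composites homotopic to the identity, and [G F] and
    [F G] have equal traces. *)
Lemma hs_trace_resolution M (Q Q' : fp_resolution M)
    (t : forall k, seq ({linear res_mod Q k -> A^o} * res_mod Q k))
    (t' : forall k, seq ({linear res_mod Q' k -> A^o} * res_mod Q' k)) N :
  (forall k, dual_basis (t k)) -> (forall k, dual_basis (t' k)) ->
  (res_len Q <= N)%N -> (res_len Q' <= N)%N ->
  \sum_(k < N.+1) hs_trace tau (t k) id *~ (-1) ^+ k =
  \sum_(k < N.+1) hs_trace tau (t' k) id *~ (-1) ^+ k.
Proof.
move=> tP t'P leN le'N.
have [F [F0 FS]] := chain_map_exists Q Q'; have [G [G0 GS]] := chain_map_exists Q' Q.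
transitivity (\sum_(k < N.+1) hs_trace tau (t k) (G k \o F k) *~ (-1) ^+ k).
  apply/eqP; rewrite -subr_eq0 -sumrB; apply/eqP.
  rewrite -[RHS](hs_trace_null (E := fun k => idfun \- (G k \o F k)) tP leN).
  - by apply: eq_bigr => k _; rewrite -mulrzBl -hs_traceB.
  - by move=> x; rewrite /= linearB /= G0 F0 subrr.
  - by move=> k x; rewrite /= linearB /= GS FS.
apply/esym/eqP; rewrite -subr_eq0 -sumrB; apply/eqP.
rewrite -[RHS](hs_trace_null (E := fun k => idfun \- (F k \o G k)) t'P le'N).
- apply: eq_bigr => k _; rewrite -mulrzBl (hs_traceC tauC (F k) (G k) (tP k) (t'P k)).
  by rewrite -hs_traceB.
- by move=> x; rewrite /= linearB /= F0 G0 subrr.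
- by move=> k x; rewrite /= linearB /= FS GS.
Qed.

Lemma commutator_span_trace a : a \in @commutator_span R A -> tau a = 0.
Proof.
move=> /asboolP[r [rX ->]]; rewrite raddf_sum big_seq big1 // => u ur.
have [x [y ->]] := rX u ur.
by rewrite scalerBr scalerAl raddfB /= tauC -scalerAr subrr.
Qed.

(** The representative chosen by [repr] differs from [a] by an element of the commutator span, which
    [tau] kills. *)
Lemma trace_repr_pi a : tau (repr (\pi_(abelianization A) a)%qT) = tau a.
Proof.
apply/eqP; rewrite -subr_eq0 -raddfB commutator_span_trace //.
by rewrite Quotient.idealrBE reprK.
Qed.

Lemma trace_reprD x y :
  tau (repr (x + y : abelianization A)) = tau (repr x) + tau (repr y).
Proof.
have -> : x + y = (\pi_(abelianization A) (repr x + repr y))%qT.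
  by rewrite raddfD /= !reprK.
by rewrite trace_repr_pi raddfD.
Qed.

Lemma hs_trace_sum_pad M (Q : fp_resolution M)
    (t : forall k, seq ({linear res_mod Q k -> A^o} * res_mod Q k)) N d :
  (res_len Q <= N)%N ->
  \sum_(k < (N + d).+1) hs_trace tau (t k) id *~ (-1) ^+ k =
  \sum_(k < N.+1) hs_trace tau (t k) id *~ (-1) ^+ k.
Proof.
move=> leN; elim: d => [|d IHd]; first by rewrite addn0.
rewrite addnS big_ord_recr /= IHd.
suff -> : hs_trace tau (t (N + d).+1) id = 0 by rewrite mul0rz addr0.
rewrite /hs_trace big1 // => u _; rewrite (@res_bounded _ _ Q (N + d).+1 _ u.2).
  by rewrite linear0 raddf0.
by rewrite ltnS (leq_trans leN) ?leq_addr.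
Qed.

Lemma trace_repr_additive :
  additive (fun x : abelianization A => tau (repr x)).
Proof. by move=> x y; apply/eqP; rewrite eq_sym subr_eq -trace_reprD subrK. Qed.

(** A dual basis exists, so [xget] returns the class given by some dual basis and not its
    default. *)
Lemma hs_rank_proj_trace (P : lmodType A) :
  finitely_generated P -> projective P ->
  exists2 t, dual_basis (P := P) t & tau (repr (hs_rank_proj P)) = hs_trace tau t id.
Proof.
move=> fgP projP; have [t0 t0P] := fg_projective_dual_basis fgP projP.
have [t [tP E]] := @xgetPex _ 0
  [set r | exists t, (forall x : P, hs_gamma t x = x) /\ r = hs_ev t]
  (ex_intro _ _ (ex_intro _ t0 (conj t0P erefl))).
by exists t => //; rewrite /hs_rank_proj E /hs_ev trace_repr_pi raddf_sum.
Qed.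

(** Frees the rank from the resolution and dual bases selected by choice: any explicit resolution
    with any dual bases computes its image under [tau]. *)
Lemma hs_rank_trace M (Q : fp_resolution M)
    (t : forall k, seq ({linear res_mod Q k -> A^o} * res_mod Q k)) N :
  (forall k, dual_basis (t k)) -> (res_len Q <= N)%N ->
  tau (repr (hs_rank M)) = \sum_(k < N.+1) hs_trace tau (t k) id *~ (-1) ^+ k.
Proof.
move=> tP leN; have [Q' E] := @xgetPex _ 0 [set r | exists Q : fp_resolution M,
    r = \sum_(k < (res_len Q).+1) hs_rank_proj (res_mod Q k) *~ (-1) ^+ k]
  (ex_intro _ _ (ex_intro _ Q erefl)).
pose f : {additive abelianization A -> V} :=
  HB.pack (fun x : abelianization A => tau (repr x)) (GRing.isZmodMorphism.Build _ _
    _ trace_repr_additive).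
have fE x : f x = tau (repr x) by [].
rewrite -fE /hs_rank E raddf_sum.
have T k : {t | dual_basis (P := res_mod Q' k) t /\
    tau (repr (hs_rank_proj (res_mod Q' k))) = hs_trace tau t id}.
  apply: cid; have [t0 t0P t0E] := hs_rank_proj_trace (@res_fg _ _ Q' k) (@res_proj _
    _ Q' k).
  by exists t0.
pose t' k := projT1 (T k); have t'P k := projT2 (T k).
(* Both sums are padded to the common length [N + res_len Q'] before they are compared. *)
rewrite -(hs_trace_sum_pad t (res_len Q') leN).
rewrite (hs_trace_resolution (t' := t') tP (fun k => (t'P k).1)) ?leq_addl
  ?(leq_trans leN) ?leq_addr //.
rewrite addnC hs_trace_sum_pad //; apply: eq_bigr => k _.
by rewrite raddfMz fE (t'P k).2.
Qed.

End Resolutions.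

(** * Direct sums of left ideals generated by idempotents *)

Section IdempotentSum.
Variables (R : comNzRingType) (A : algType R) (X : finType) (c : X -> A).

(** For an idempotent [c j] the condition [x_j c_j = x_j] describes the left ideal [A c_j]; the
    direct sum of these ideals is kept inside one free module, so that its elements are plain
    families. *)
Definition idem_pred : {pred {ffun X -> A^o}} :=
  fun x => [forall j, (x j : A) * c j == x j].

Lemma idem_pred_closed : GRing.submod_closed idem_pred.
Proof.
split=> [|a x y /forallP xc /forallP yc]; apply/forallP => j.
  by rewrite ffunE mul0r.
rewrite !ffunE -[a *: x j]/(a * (x j : A)) mulrDl -mulrA.
by rewrite (eqP (xc j)) (eqP (yc j)).
Qed.

HB.instance Definition _ := GRing.isSubmodClosed.Build A {ffun X -> A^o} idem_pred
  idem_pred_closed.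

Record idem_sum : Type := IdemSum {
  idem_val :> {ffun X -> A^o}; _ : idem_val \in idem_pred }.

HB.instance Definition _ := [isSub for idem_val].
HB.instance Definition _ := [Choice of idem_sum by <:].
HB.instance Definition _ := [SubChoice_isSubLmodule of idem_sum by <:].

Lemma idem_sum_eq (x y : idem_sum) : (forall j, x j = y j) -> x = y.
Proof. by move=> xy; apply/val_inj/ffunP. Qed.

Lemma idem_sumK (x : idem_sum) j : (x j : A) * c j = x j.
Proof. by case: x => x /= /forallP/(_ j)/eqP. Qed.

Definition mk_idem (f : X -> A) (fc : forall j, f j * c j = f j) : idem_sum.
Proof.
exists [ffun j => f j : A^o]; apply/forallP => j; rewrite !ffunE; apply/eqP/fc.
Defined.

Lemma mk_idemE f fc j : @mk_idem f fc j = f j.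
Proof. by rewrite /= ffunE. Qed.

Lemma idem_sumD (x y : idem_sum) j : (x + y) j = x j + y j.
Proof. by rewrite -[idem_val (x + y)]/(val (x + y)) raddfD ffunE. Qed.

Lemma idem_sumZ a (x : idem_sum) j : (a *: x) j = a * (x j : A).
Proof. by rewrite -[idem_val _]/(val (a *: x)) linearZ ffunE. Qed.

Lemma idem_sum_sum I (r : seq I) (F : I -> idem_sum) j :
  (\sum_(i <- r) F i) j = \sum_(i <- r) F i j.
Proof. by rewrite -[idem_val _]/(val (\sum_(i <- r) F i)) raddf_sum sum_ffunE. Qed.

Hypothesis cc : forall j, c j * c j = c j.

Lemma idem_coord_linear j : linear (fun x : idem_sum => x j : A^o).
Proof. by move=> a x y; rewrite idem_sumD idem_sumZ. Qed.

Lemma idem_gen_subproof j k : (if k == j then c j else 0) * c k = if k == j then c j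
  else 0.
Proof. by case: eqP => [->|_]; rewrite ?cc ?mul0r. Qed.

Definition idem_gen j : idem_sum := mk_idem (idem_gen_subproof j).

Definition idem_dual : seq ({linear idem_sum -> A^o} * idem_sum) :=
  [seq (mk_linear (idem_coord_linear j), idem_gen j) | j <- enum X].

Lemma idem_dual_basis : dual_basis idem_dual.
Proof.
move=> x; apply: idem_sum_eq => k; rewrite /hs_gamma big_map idem_sum_sum big_enum.
transitivity (\sum_j (x j : A) * (idem_gen j k : A)).
  by apply: eq_bigr => j _; exact: idem_sumZ.
rewrite (bigD1 k) // mk_idemE eqxx idem_sumK big1 => [|j /negPf jk];
  first exact: addr0.
by rewrite mk_idemE eq_sym jk mulr0.
Qed.

Lemma idem_dual_trace (V : zmodType) (tau : {additive A -> V}) :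
  hs_trace tau idem_dual id = \sum_j tau (c j).
Proof.
rewrite /hs_trace big_map big_enum; apply: eq_bigr => j _.
have genE : idem_gen j j = c j by rewrite mk_idemE eqxx.
exact: (congr1 tau genE).
Qed.

End IdempotentSum.

(** * Bases indexed by a set *)

Section Families.
Variables (R : comNzRingType) (W : choiceType) (V : lmodType R).
Implicit Types (X : set W) (b : W -> V).

(** Combinations are indexed by elements of [W] instead of vectors, so that coefficients are
    functions of group elements. *)
Definition fam_span X b : set V :=
  [set v | exists r : seq (R * W),
     (forall u, u \in r -> X u.2) /\ v = \sum_(u <- r) u.1 *: b u.2].

Definition fam_free X b : Prop :=
  forall (r : seq W) (c : W -> R), uniq r -> (forall w, w \in r -> X w) ->
    \sum_(w <- r) c w *: b w = 0 -> forall w, w \in r -> c w = 0.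

Definition fam_basis X b : Prop := (forall v, fam_span X b v) /\ fam_free X b.

Lemma fam_span0 X b : fam_span X b 0.
Proof. by exists [::]; split=> //; rewrite big_nil. Qed.

Lemma fam_spanD X b v v' : fam_span X b v -> fam_span X b v' -> fam_span X b (v + v').
Proof.
move=> [r [rX ->]] [r' [r'X ->]]; exists (r ++ r'); split; last by rewrite big_cat.
by move=> u; rewrite mem_cat => /orP[/rX|/r'X].
Qed.

Lemma fam_spanZ X b (c : R) w : X w -> fam_span X b (c *: b w).
Proof.
move=> Xw; exists [:: (c, w)]; split; last by rewrite big_seq1.
by move=> u; rewrite inE => /eqP->.
Qed.

Lemma fam_span_sum X b (J : eqType) (r : seq J) (F : J -> V) :
  (forall j, j \in r -> fam_span X b (F j)) -> fam_span X b (\sum_(j <- r) F j).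
Proof.
elim: r => [|j r IHr] rF; first by rewrite big_nil; exact: fam_span0.
rewrite big_cons; apply: fam_spanD; first by apply: rF; rewrite mem_head.
by apply: IHr => k kr; apply: rF; rewrite inE kr orbT.
Qed.

Lemma fam_span_image X b v : fam_span X b v <-> lin_span (b @` X) v.
Proof.
split=> [[r [rX ->]]|[r [rX ->]]].
  exists [seq (u.1, b u.2) | u <- r]; split; last by rewrite big_map.
  by move=> _ /mapP[u ur ->] /=; exists u.2 => //; exact: rX.
rewrite big_seq; elim/big_ind: _ => [||u ur]; [exact: fam_span0|exact: fam_spanD|].
by have [w Xw <-] := rX u ur; exact: fam_spanZ.
Qed.

Lemma fam_basis_image X b : fam_basis X b -> free_basis (b @` X).
Proof.
move=> [bspan bfree]; split=> [v|r c ur rX rc]; first exact/fam_span_image.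
have [r' r'X r'E] : exists2 r', (forall w, w \in r' -> X w) & r = map b r'.
  elim: r {ur rc} rX => [|v r IHr] rX; first by exists [::].
  have [w Xw bw] := rX v (mem_head _ _).
  have [|r' r'X r'E] := IHr; first by move=> u ur; apply: rX; rewrite inE ur orbT.
  exists (w :: r'); last by rewrite /= bw r'E.
  by move=> w'; rewrite inE => /orP[/eqP->|/r'X].
move: ur rc; rewrite r'E big_map => /map_uniq ur /(bfree r' (c \o b) ur r'X) cb.
by move=> _ /mapP[w wr ->]; exact: cb.
Qed.

Lemma free_basis_fam X b : {in X &, injective b} -> free_basis (b @` X) -> fam_basis
  X b.
Proof.
move=> binj [bspan bfree]; split=> [v|r c ur rX rc w wr]; first exact/fam_span_image.
have buniq : uniq (map b r).
  by rewrite map_inj_in_uniq // => w1 w2 w1r w2r; apply: binj; rewrite inE; exact: rX.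
pose c' v := if pselect (exists2 w, X w & b w = v) is left ex then c (projT1 (cid2
  ex)) else 0.
have c'b w' : w' \in r -> c' (b w') = c w'.
  move=> /rX Xw'; rewrite /c'; case: pselect => [ex|[]]; last by exists w'.
  by case: cid2 => /= w2 Xw2 /binj ->; rewrite ?inE.
rewrite -c'b //; apply: (bfree (map b r)) => //.
- by move=> _ /mapP[w' w'r ->]; exists w' => //; exact: rX.
- by rewrite big_map -[RHS]rc; apply: eq_big_seq => w' w'r; rewrite c'b.
- exact: map_f.
Qed.

(** Collects repeated indices, since freeness speaks of lists without repetition. *)
Lemma fam_collect (U : lmodType R) (r : seq (R * W)) (f : W -> U) :
  \sum_(u <- r) u.1 *: f u.2 =
  \sum_(w <- undup (map snd r)) (\sum_(u <- r | u.2 == w) u.1) *: f w.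
Proof.
under [RHS]eq_bigr => w _ do rewrite scaler_suml big_mkcond.
rewrite exchange_big /=; apply: eq_big_seq => u ur.
rewrite (bigD1_seq u.2) ?undup_uniq ?mem_undup ?map_f //= eqxx big1 ?addr0 //.
by move=> w /negPf wu; rewrite eq_sym wu.
Qed.

(** The value at [v] is computed from a chosen expansion. The difference of two expansions is a
    relation among the [b w], hence by [rel] one among the [f w], so the choice does not matter. *)
Lemma fam_ext X b (U : lmodType R) (f : W -> U) : fam_basis X b ->
  exists F : {linear V -> U}, forall w, X w -> F (b w) = f w.
Proof.
move=> [bspan bfree].
have rel r : (forall u, u \in r -> X u.2) -> \sum_(u <- r) u.1 *: b u.2 = 0 ->
    \sum_(u <- r) u.1 *: f u.2 = 0.
  move=> rX; rewrite !fam_collect => /bfree c0; rewrite big_seq big1 // => w wr.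
  rewrite c0 ?scale0r ?undup_uniq // => w'.
  by rewrite mem_undup => /mapP[u ur ->]; exact: rX.
pose F v := \sum_(u <- projT1 (cid (bspan v))) u.1 *: f u.2.
have FP r : (forall u, u \in r -> X u.2) ->
    F (\sum_(u <- r) u.1 *: b u.2) = \sum_(u <- r) u.1 *: f u.2.
  move=> rX; rewrite /F; case: cid => r' /= [r'X E].
  have N (U' : lmodType R) (g : W -> U') :
      \sum_(u <- [seq (- u.1, u.2) | u <- r']) u.1 *: g u.2 = - \sum_(u <- r') u.1 *:
        g u.2.
    by rewrite big_map -sumrN; apply: eq_bigr => u _; rewrite scaleNr.
  have := rel (r ++ [seq (- u.1, u.2) | u <- r']).
  rewrite !big_cat !N /= -E subrr => relE; apply/esym/eqP; rewrite -subr_eq0 relE //.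
  by move=> u; rewrite mem_cat => /orP[/rX//|/mapP[u' /r'X ? ->]].
have F_lin : linear F.
  move=> a v v'; have [r [rX vE]] := bspan v; have [r' [r'X v'E]] := bspan v'.
  have -> : a *: v + v' = \sum_(u <- [seq (a * u.1, u.2) | u <- r] ++ r') u.1 *: b
    u.2.
    rewrite big_cat big_map vE v'E scaler_sumr; congr (_ + _).
    by apply: eq_bigr => u _; rewrite scalerA.
  rewrite FP => [|u]; last first.
    by rewrite mem_cat => /orP[/mapP[u' /rX ? ->]|/r'X].
  rewrite big_cat big_map vE v'E !FP // scaler_sumr; congr (_ + _).
  by apply: eq_bigr => u _; rewrite scalerA.
exists (mk_linear F_lin) => w Xw.
have bE : \sum_(u <- [:: (1 : R, w)]) u.1 *: b u.2 = b w by rewrite big_seq1 scale1r.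
change (F (b w) = f w); rewrite -bE FP ?big_seq1 ?scale1r // => u; rewrite inE.
by move=> /eqP ->.
Qed.

Lemma fam_coef_exists X b : fam_basis X b ->
  exists coef : W -> {linear V -> R^o},
    (forall v w, X v -> coef w (b v) = (v == w)%:R) /\
    (forall a, exists r, [/\ uniq r, forall w, w \in r -> X w
                           & a = \sum_(w <- r) coef w a *: b w]).
Proof.
move=> bB; have coefP w := cid (fam_ext (fun v => (v == w)%:R : R^o) bB).
exists (fun w => projT1 (coefP w)); split=> [v w Xv|a].
  by case: coefP => F /= ->.
have [r [rX aE]] := bB.1 a; exists (undup (map snd r)).
have rX' w : w \in undup (map snd r) -> X w.
  by rewrite mem_undup => /mapP[u ur ->]; exact: rX.
split=> //; first exact: undup_uniq.
rewrite {1}aE fam_collect; apply: eq_big_seq => w wr; congr (_ *: _).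
case: coefP => F /= FP; rewrite aE linear_sum /= big_mkcond;
  apply: eq_big_seq => u ur.
rewrite linearZ /= FP; last exact: rX.
by case: (u.2 == w); rewrite /GRing.scale /= ?mulr1 ?mulr0.
Qed.

End Families.

(** * Hecke algebras *)

(** The Hecke algebra of [W_I], with [T] indexed by all of [W] but constrained on [W_I] only, and
    with the length inherited from [W]. This treats [H] itself and each [H_I] uniformly. *)
Record parabolic_hecke (W : groupType) (S : finType) (s : S -> W)
    (R : comNzRingType) (q : R) (A : algType R) (I : {set S}) (T : W -> A) : Prop :=
  ParabolicHecke {
  ph_basis : fam_basis (parabolic s I) T;
  ph_one : T 1%g = 1;
  ph_up : forall i w, i \in I -> parabolic s I w ->
    (len s w < len s (s i * w)%g)%N -> T (s i) * T w = T (s i * w)%g;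
  ph_down : forall i w, i \in I -> parabolic s I w ->
    (len s (s i * w)%g < len s w)%N ->
    T (s i) * T w = (q - 1) *: T w + q *: T (s i * w)%g }.

Section ParabolicHecke.
Variables (W : groupType) (S : finType) (m : S -> S -> option nat) (s : S -> W).
Hypothesis hW : coxeter_system m s.
Variables (R : comNzRingType) (q : R) (A : algType R) (I : {set S}) (T : W -> A).
Hypothesis hT : parabolic_hecke s q I T.

Local Notation WI := (parabolic s I).
Local Notation len := (len s).

Lemma len_simple i : len (s i) = 1%N.
Proof. by have := len_up hW (w := 1%g) (i := i); rewrite mul1g (len1 s); apply. Qed.

(** Letters of a reduced word of [x] are peeled off from the left; additivity of length forces every
    step to be an ascent. *)
Lemma hecke_mul x y : WI x -> WI y -> len (x * y)%g = (len x + len y)%N ->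
  T x * T y = T (x * y)%g.
Proof.
move=> /(reduced_word hW)[u [uI us ux _]] Iy.
elim: u x uI us ux => [|i u IHu] x uI us ux lxy.
  by rewrite -ux /word big_nil (ph_one hT) !mul1r mul1g.
have iI : i \in I by apply: uI; rewrite mem_head.
have u'I : {subset u <= I} by move=> j ju; apply: uI; rewrite inE ju orbT.
set x' := word s u; have xE : x = (s i * x')%g by rewrite -ux word_cons.
have Ix' : WI x' by apply/(parabolicP hW); exists u.
have lx' : len x' = size u.
  have := len_word s u; have := lenM hW (s i) x'.
  by rewrite -xE -us len_simple -/x' /=; lia.
have lx'y : len (x' * y)%g = (len x' + len y)%N.
  have := lenM hW x' y; have := lenM hW (s i) (x' * y)%g.
  by rewrite mulgA -xE lxy -us len_simple lx' /=; lia.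
have -> : T x = T (s i) * T x'.
  by rewrite xE (ph_up hT) // -xE -us lx' ltnS.
rewrite -mulrA IHu // (ph_up hT) //; first by rewrite mulgA -xE.
  exact: parabolicM.
by rewrite mulgA -xE lxy lx'y -us lx' /=.
Qed.

Lemma hecke_right_up w i : i \in I -> WI w -> (len w < len (w * s i)%g)%N ->
  T w * T (s i) = T (w * s i)%g.
Proof.
move=> iI Iw lt_wi; apply: hecke_mul => //; first exact: parabolic_simple.
by rewrite len_simple addn1 (len_up hW) // -(len_simple_ltn hW).
Qed.

Lemma hecke_simple2 i : i \in I -> T (s i) * T (s i) = (q - 1) *: T (s i) + q *: 1.
Proof.
move=> iI; rewrite (ph_down hT) ?(simpleK hW) ?(ph_one hT) //;
  first exact: parabolic_simple.
by rewrite (len1 s) len_simple.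
Qed.

Lemma hecke_right_down w i : i \in I -> WI w -> (len (w * s i)%g < len w)%N ->
  T w * T (s i) = (q - 1) *: T w + q *: T (w * s i)%g.
Proof.
move=> iI Iw lt_wi; have Iwi := parabolicM Iw (parabolic_simple iI).
have wE : T w = T (w * s i)%g * T (s i).
  by rewrite hecke_right_up // -mulgA (simpleK hW) mulg1.
by rewrite {1}wE -mulrA hecke_simple2 // mulrDr -!scalerAr -wE mulr1.
Qed.

Definition coef : W -> {linear A -> R^o} := projT1 (cid (fam_coef_exists (ph_basis
  hT))).

Lemma coefT v w : WI v -> coef w (T v) = (v == w)%:R.
Proof. by move=> Iv; rewrite /coef; case: cid => c /= [-> ]. Qed.

Lemma coef_expand a : exists r, [/\ uniq r, forall w, w \in r -> WI w
  & a = \sum_(w <- r) coef w a *: T w].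
Proof. by rewrite /coef; case: cid => c /= [_ /(_ a)]. Qed.

(** As [w] ascends under [s i], neither an ascending product nor a [(q - 1)]-term can produce [T w];
    only [T v] with [v = w s_i] contributes, with the factor [q]. *)
Lemma coef_right w i a : i \in I -> WI w -> (len w < len (w * s i)%g)%N ->
  coef w (a * T (s i)) = q * coef (w * s i)%g a :> R.
Proof.
move=> iI Iw lt_wi; have [r [_ rI ->]] := coef_expand a.
rewrite mulr_suml !linear_sum mulr_sumr; apply: eq_big_seq => v /rI Iv.
rewrite -scalerAl !linearZ /= [RHS]mulrCA; congr (_ * _); rewrite coefT //.
have siK x : (x * s i * s i)%g = x by rewrite -mulgA (simpleK hW) mulg1.
have Ivi := parabolicM Iv (parabolic_simple iI).
have [lt_vi|] := boolP (len (v * s i)%g < len v)%N; last first.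
  rewrite -(len_simple_ltn hW) => lt_vi; rewrite hecke_right_up // coefT //.
  have /negPf-> : (v * s i)%g != w.
    by apply: contraTneq lt_vi => E; rewrite E -leqNgt -[v]siK E ltnW.
  have /negPf-> : v != (w * s i)%g.
    by apply: contraTneq lt_vi => ->; rewrite siK -leqNgt ltnW.
  by rewrite mulr0.
rewrite hecke_right_down // linearD !linearZ /= !coefT //.
have /negPf-> : v != w by apply: contraTneq lt_vi => ->; rewrite -leqNgt ltnW.
have -> : ((v * s i)%g == w) = (v == (w * s i)%g).
  by apply/eqP/eqP => [<-|->]; rewrite siK.
by rewrite scaler0 add0r.
Qed.

Section Alternating.
Variables (J : {set S}) (w : W).
Hypotheses (JI : J \subset I) (Iw : WI w) (Jw : descends s J w).

(* On each coset [w W_J] the coefficients of an element killed by all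
   [T (s i) + 1], [i \in J], are determined by the one at the longest element. *)
Definition alternating : A :=
  \sum_(u <- fset_set (parabolic s J)) (- q) ^+ len u *: T (w * u)%g.

Lemma mem_parabolic u : (u \in fset_set (parabolic s J)) = `[< parabolic s J u >].
Proof.
by rewrite in_fset_set ?inE //; exact: (descends_spherical hW Jw).
Qed.

Lemma parabolic_coset u : u \in fset_set (parabolic s J) -> WI (w * u)%g.
Proof. by rewrite mem_parabolic => /asboolP Ju; apply: parabolicM => //;
  exact: (parabolicS hW JI). Qed.

Lemma len_coset u : u \in fset_set (parabolic s J) -> (len (w * u)%g + len u)%N = len
  w.
Proof.
by rewrite mem_parabolic => /asboolP Ju; apply: (len_descents hW) Ju; apply/descendsP.
Qed.

(** The terms with [u != 1] have length strictly below [len w]; this is the unitriangularity of the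
    alternating elements. *)
Lemma coef_alternating v : WI v -> (len w <= len v)%N ->
  coef v alternating = (w == v)%:R.
Proof.
move=> Iv le_wv; rewrite linear_sum (bigD1_seq 1%g) ?fset_uniq //=; last first.
  by rewrite mem_parabolic; apply/asboolP; exact: (parabolic1 hW).
rewrite len1 expr0 scale1r mulg1 coefT // big_seq_cond big1 ?addr0 // => u /andP[Ju
  u1].
rewrite linearZ /= coefT; last exact: parabolic_coset.
have /negPf-> : (w * u)%g != v; last exact: mulr0.
apply: contraNneq u1 => E; apply/eqP/(len_eq0 hW).
by have := len_coset Ju; rewrite E; lia.
Qed.

(** Pairing [u] with [u s_i] groups the sum into multiples of [T_(wu) - q T_(w u s_i)], and right
    multiplication by [T (s i)] negates each of these. *)
Lemma alternating_anti i : i \in J -> alternating * T (s i) = - alternating.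
Proof.
move=> iJ; have iI : i \in I by exact: (fintype.subsetP JI).
have siK x : (x * s i * s i)%g = x by rewrite -mulgA (simpleK hW) mulg1.
pose down u := (len (u * s i)%g < len u)%N.
have downs u : down (u * s i)%g = ~~ down u by rewrite /down siK (len_simple_ltn hW).
have JM u : u \in fset_set (parabolic s J) -> (u * s i)%g \in fset_set (parabolic s
  J).
  rewrite !mem_parabolic => /asboolP Ju; apply/asboolP; apply: parabolicM => //.
  exact: parabolic_simple.
pose G u := T (w * u)%g - q *: T (w * u * s i)%g.
have altE : alternating = \sum_(u <- fset_set (parabolic s J) | ~~ down u) (- q) ^+
  len u *: G u.
  rewrite /alternating (bigID down) /= addrC.
  have perm : perm_eq (fset_set (parabolic s J)) [seq (u * s i)%g | u <- fset_set
    (parabolic s J)].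
    apply: uniq_perm; rewrite ?fset_uniq // ?map_inj_uniq ?fset_uniq //;
      first exact: mulIg.
    move=> u; apply/idP/mapP => [/JM Ju|[v /JM Jv ->//]].
    by exists (u * s i)%g; rewrite ?siK.
  rewrite [X in _ + X](perm_big _ perm) big_map [X in _ + X](eq_bigl _ _ downs).
  rewrite -big_split /=; apply: eq_bigr => u; rewrite -(len_simple_ltn hW) => up_u.
  by rewrite (len_up hW) -?(len_simple_ltn hW) // exprSr mulrN scaleNr -scalerA
    -scalerBr mulgA.
rewrite altE mulr_suml -sumrN big_seq_cond [RHS]big_seq_cond; apply: eq_bigr => u.
move=> /andP[Ju up_u]; rewrite -scalerAl -scalerN; congr (_ *: _).
have Jui := JM u Ju; have E1 := len_coset Ju; have E2 := len_coset Jui.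
rewrite -(len_simple_ltn hW) in up_u.
(* Length on the coset is [len w - len u], so an ascent of [u] is a descent of [w * u]. *)
have lt : (len (w * u * s i)%g < len (w * u)%g)%N.
  have lu : len (u * s i)%g = (len u).+1 by rewrite (len_up hW) -?(len_simple_ltn hW).
  by rewrite -(ltn_add2r (len u)) E1 -E2 mulgA lu addnS.
rewrite /G mulrBl hecke_right_down //; last exact: parabolic_coset.
rewrite -scalerAl hecke_right_up ?siK //; last by rewrite -mulgA;
  exact: parabolic_coset.
by rewrite opprB scalerBl scale1r addrAC [X in X - _]addrC addrK addrC.
Qed.

End Alternating.

Definition descents w : {set S} := [set i in I | (len (w * s i)%g < len w)%N].

Lemma descents_sub w : descents w \subset I.
Proof. by apply/fintype.subsetP => i; rewrite inE => /andP[]. Qed.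

Lemma descends_descents w : descends s (descents w) w.
Proof. by apply/descendsP => i; rewrite inE => /andP[]. Qed.

Lemma descendsE (J : {set S}) w : J \subset I -> descends s J w = (J \subset descents
  w).
Proof.
move=> JI; apply/descendsP/fintype.subsetP => [Jw i iJ|Jw i /Jw];
  last by rewrite inE => /andP[].
by rewrite inE Jw // (fintype.subsetP JI).
Qed.

(** The last letter of a reduced word is a descent. *)
Lemma descents_eq0 w : WI w -> descents w = finset.set0 -> w = 1%g.
Proof.
move=> /(reduced_word hW)[u [uI us uw _]] D0.
case: (lastP u) uI us uw => [_ _ <-|u' i u'I us uw]; first by rewrite /word big_nil.
have : i \in descents w; last by rewrite D0 inE.
rewrite inE u'I ?mem_rcons ?mem_head //= -us size_rcons ltnS.
rewrite -uw -cats1 word_cat /word big_seq1 -mulgA (simpleK hW) mulg1.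
exact: len_word.
Qed.

Definition alt_basis w : A := alternating (descents w) w.

Lemma coef_alt_basis w v : WI w -> WI v -> (len w <= len v)%N ->
  coef v (alt_basis w) = (w == v)%:R.
Proof.
move=> Iw; exact: coef_alternating (descents_sub w) Iw (descends_descents w) v.
Qed.

Definition anti (J : {set S}) (a : A) : Prop := forall i, i \in J -> a * T (s i) = -
  a.

Lemma anti_alt_basis (J : {set S}) w : WI w -> J \subset descents w -> anti J
  (alt_basis w).
Proof.
move=> Iw /fintype.subsetP JD i /JD.
exact: alternating_anti (descents_sub w) Iw (descends_descents w) i.
Qed.

Lemma anti0 J : anti J 0.
Proof. by move=> i _; rewrite mul0r oppr0. Qed.

Lemma antiD J a b : anti J a -> anti J b -> anti J (a + b).
Proof. by move=> Ja Jb i iJ; rewrite mulrDl Ja ?Jb // opprD. Qed.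

Lemma antiZ J (c : R) a : anti J a -> anti J (c *: a).
Proof. by move=> Ja i iJ; rewrite -scalerAl Ja // scalerN. Qed.

Lemma antiM J a b : anti J b -> anti J (a * b).
Proof. by move=> Jb i iJ; rewrite -mulrA Jb // mulrN. Qed.

Lemma anti_sum J (K : eqType) (r : seq K) (P : pred K) (F : K -> A) :
  (forall k, k \in r -> P k -> anti J (F k)) -> anti J (\sum_(k <- r | P k) F k).
Proof.
move=> rF; rewrite big_seq_cond; apply: big_ind => [||k /andP[]].
- exact: anti0.
- by move=> a b; exact: antiD.
- exact: rF.
Qed.

Lemma antiS (J K : {set S}) a : K \subset J -> anti J a -> anti K a.
Proof. by move=> /fintype.subsetP KJ Ja i /KJ/Ja. Qed.

(** Compare coefficients at [w] in [a T_i = - a]: at an ascent the left one is [q] times the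
    coefficient at [w s_i]. The hypothesis holds at the longest elements of the support of [a]. *)
Lemma anti_coef (J : {set S}) a w : J \subset I -> anti J a -> WI w ->
  (forall i, i \in J -> (len w < len (w * s i)%g)%N -> coef (w * s i)%g a = 0 :> R)
    -> coef w a != 0 :> R ->
  J \subset descents w.
Proof.
move=> JI Ja Iw c0; apply: contraR => /fintype.subsetPn[i iJ].
have iI := fintype.subsetP JI i iJ; rewrite inE iI /= -(len_simple_ltn hW) => up_i.
by rewrite -oppr_eq0 -linearN -(Ja i iJ) coef_right // c0 // mulr0.
Qed.

Lemma coef_eq0_bound a : exists n, forall w, WI w -> (n <= len w)%N -> coef w a = 0
  :> R.
Proof.
have [r [_ rI aE]] := coef_expand a.
exists (\max_(w <- r) len w).+1 => w Iw lew; rewrite aE linear_sum big_seq big1 // =>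
  v vr.
rewrite linearZ /= coefT; last exact: rI.
suff /negPf-> : v != w by exact: mulr0.
apply: contraTneq lew => <-; rewrite -leqNgt.
exact: (@leq_bigmax_seq _ r xpredT (fun w => len w)).
Qed.

(** Induction on a bound for the lengths in the support: subtract the combination [b] of the
    [alt_basis w] having the same coefficients in the top length. By [anti_coef] every [w] involved
    has [J] among its descents. *)
Lemma anti_span (J : {set S}) a : J \subset I -> anti J a ->
  fam_span [set w | WI w /\ J \subset descents w] alt_basis a.
Proof.
move=> JI; have [n] := coef_eq0_bound a; elim: n a => [|n IHn] a a0 Ja.
  have [r [_ rI ->]] := coef_expand a; rewrite big_seq big1; first exact: fam_span0.
  by move=> w /rI Iw; rewrite a0 // scale0r.
have [r [ur rI aE]] := coef_expand a.
pose b := \sum_(w <- r | len w == n) (coef w a : R) *: alt_basis w.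
have wJ w : w \in r -> len w == n -> coef w a != 0 :> R -> J \subset descents w.
  move=> wr /eqP wn; apply: anti_coef (rI w wr) _ => // i iJ; rewrite wn => lt_ni.
  by apply: a0 => //; exact: parabolicM (rI w wr) (parabolic_simple (fintype.subsetP
    JI i iJ)).
have bspan : fam_span [set w | WI w /\ J \subset descents w] alt_basis b.
  rewrite /b -big_filter; apply: fam_span_sum => w;
    rewrite mem_filter => /andP[wn wr].
  have [->|c0] := eqVneq (coef w a : R) 0; first by rewrite scale0r; exact: fam_span0.
  by apply: fam_spanZ; split; [exact: rI|exact: wJ].
have Jb : anti J b.
  apply: anti_sum => w wr wn; have [->|c0] := eqVneq (coef w a : R) 0.
    by rewrite scale0r; exact: anti0.
  by apply/antiZ/anti_alt_basis; [exact: rI|exact: wJ].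
rewrite -(subrK b a); apply: fam_spanD => //; apply: IHn; last first.
  by rewrite -scaleN1r; apply: antiD => //; exact: antiZ.
move=> v Iv nv; rewrite linearB /= {1}aE /b !linear_sum /=.
(* Terms with [len w = n] cancel by unitriangularity. Another term could matter only for [w = v],
   where [len v > n] and the coefficient of [a] is zero. *)
rewrite (bigID (fun w => len w == n)) /= addrAC -big_split /=.
rewrite big_seq_cond big1 => [|w /andP[/rI Iw /eqP wn]]; last first.
  have -> : coef v (coef w a *: T w) = coef v (coef w a *: alt_basis w).
    by rewrite !linearZ /= coefT // coef_alt_basis ?wn.
  exact: subrr.
rewrite add0r big_seq_cond big1 // => w /andP[/rI Iw wn]; rewrite linearZ /= coefT //.
case: eqP => [wv|_]; last exact: mulr0.
rewrite (a0 w) //; first exact: mul0r.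
by rewrite ltn_neqAle eq_sym wn wv.
Qed.

(** Spanning is the case of empty [J] in [anti_span]. For freeness the coefficients are eliminated
    downwards from the greatest length [M]. *)
Lemma alt_basisP : fam_basis WI alt_basis.
Proof.
split=> [a|r c ur rI c0].
  have /anti_span[|r [rD ->]] : anti finset.set0 a by move=> i; rewrite inE.
    exact: finset.sub0set.
  by exists r; split=> // u /rD[].
pose M := (\max_(w <- r) len w)%N.
have leM w : w \in r -> (len w <= M)%N.
  by move=> wr; exact: (@leq_bigmax_seq _ r xpredT (fun w => len w)).
suff H n w : w \in r -> (M - len w < n)%N -> c w = 0 by move=> w wr;
  exact: (H (M - len w).+1).
elim: n w => // n IHn w wr lt_n.
have := congr1 (fun a => coef w a : R) c0; rewrite linear_sum linear0 /=.
rewrite (bigD1_seq w) //= linearZ /= (coef_alt_basis (rI w wr) (rI w wr)) // eqxx =>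
  cw.
rewrite -[RHS]cw big_seq_cond big1 => [|v /andP[vr /negPf vw]].
  by rewrite addr0; exact/esym/mulr1.
have [le_vw|lt_wv] := leqP (len v) (len w).
  rewrite linearZ /= (coef_alt_basis (rI v vr) (rI w wr)) // vw; exact: mulr0.
rewrite (IHn v) ?scale0r ?linear0 //; have := leM v vr; have := leM w wr; lia.
Qed.

End ParabolicHecke.

(** * Longest elements and parabolic subgroups of rank one *)

Section Longest.
Variables (W : groupType) (S : finType) (m : S -> S -> option nat) (s : S -> W).
Hypothesis hW : coxeter_system m s.

(** For infinite [W_J] no element descends under all of [J], and the default [1] is returned. *)
Definition longest (J : {set S}) : W :=
  xget 1%g [set u | parabolic s J u /\ descends s J u].

Lemma longestP (J : {set S}) : spherical s J ->
  parabolic s J (longest J) /\ descends s J (longest J).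
Proof.
move=> /(coset_descends hW 1%g)[u Ju]; rewrite mul1g => Du.
exact: (@xgetPex _ 1%g [set u | parabolic s J u /\ descends s J u] (ex_intro _ u
  (conj Ju Du))).
Qed.

Lemma parabolic_set1 i w : parabolic s [set i]%SET w <-> w = 1%g \/ w = s i.
Proof.
split=> [/(parabolicP hW)[u]|[->|->]]; first last.
- by apply: parabolic_simple; rewrite inE.
- exact: (parabolic1 hW).
elim: u w => [|j u IHu] w uI <-; first by left; rewrite /word big_nil.
have /set1P-> : j \in [set i]%SET by apply: uI; rewrite mem_head.
rewrite word_cons; have [|->|->] := IHu (word s u) _ erefl.
- by move=> k ku; apply: uI; rewrite inE ku orbT.
- by right; rewrite mulg1.
- by left; rewrite (simpleK hW).
Qed.

Lemma parabolic_set1_spherical i : spherical s [set i]%SET.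
Proof.
apply: (@sub_finite_set _ _ [set 1%g; s i]); last exact: finite_set2.
by move=> w /parabolic_set1[->|->]; [left|right].
Qed.

(** Evaluates the Poincaré polynomial of a rank one subgroup as [1 + q]. *)
Lemma parabolic_set1_sum (V : nmodType) (F : W -> V) i :
  \sum_(u <- fset_set (parabolic s [set i]%SET)) F u = F 1%g + F (s i).
Proof.
have perm : perm_eq (fset_set (parabolic s [set i]%SET)) [:: 1%g; s i].
  apply: uniq_perm; rewrite ?fset_uniq //= ?inE ?andbT.
    by apply/eqP => /(congr1 (len s)); rewrite len1 (len_simple hW).
  move=> w; rewrite in_fset_set ?inE; last exact: parabolic_set1_spherical.
  apply/asboolP/orP => [/parabolic_set1[->|->]|[/eqP->|/eqP->]].
  - by left.
  - by right.
  - exact: (parabolic1 hW).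
  - by apply: parabolic_simple; rewrite inE.
by rewrite (perm_big _ perm) big_cons big_seq1.
Qed.

Lemma parabolic_hecke_prod (R : comNzRingType) (q : R) (A : algType R) (I J : {set S})
    (T : W -> A) w :
  parabolic_hecke s q I T -> J \subset I -> parabolic s J w ->
  exists u, [/\ {subset u <= J}, size u = len s w & T w = \prod_(i <- u) T (s i)].
Proof.
move=> hT JI /(reduced_word hW)[u [uJ us uw _]]; exists u; split=> //.
elim: u w uJ us uw => [|i u IHu] w uJ us uw.
  by rewrite -uw /word !big_nil (ph_one hT).
have iJ : i \in J by apply: uJ; rewrite mem_head.
have u'J : {subset u <= J} by move=> j ju; apply: uJ; rewrite inE ju orbT.
set w' := word s u; have wE : w = (s i * w')%g by rewrite -uw word_cons.
have Jw' : parabolic s J w' by apply/(parabolicP hW); exists u.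
have lw' : len s w' = size u.
  have := len_word s u; have := lenM hW (s i) w'.
  by rewrite -wE -us (len_simple hW) -/w' /=; lia.
rewrite big_cons wE -(IHu w') // (ph_up hT) //; first exact: (fintype.subsetP JI).
  exact: (parabolicS hW) JI Jw'.
by rewrite -wE lw' -us /=.
Qed.

End Longest.

(** * Trace, idempotents and Koszul resolution of a parabolic Hecke algebra *)

Section EulerCharacteristic.
Variables (W : groupType) (S : finType) (m : S -> S -> option nat) (s : S -> W).
Hypothesis hW : coxeter_system m s.
Variables (R : comNzRingType) (q : R) (A : algType R) (I : {set S}) (T : W -> A).
Hypothesis hT : parabolic_hecke s q I T.

Local Notation WI := (parabolic s I).
Local Notation len := (len s).
Local Notation coef := (coef hT).
Local Notation anti := (anti s T).
Local Notation descents := (descents s I).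

(** Both sides equal [q] times the coefficient of [a] at [s i]. *)
Lemma coef1_simple i a : i \in I -> coef 1%g (T (s i) * a) = coef 1%g (a * T (s i))
  :> R.
Proof.
move=> iI; have si := len_simple hW i.
have Isi : WI (s i) by exact: parabolic_simple.
have [r [_ rI ->]] := coef_expand hT a.
rewrite mulr_suml mulr_sumr !linear_sum; apply: eq_big_seq => w /rI Iw.
rewrite -scalerAl -scalerAr !linearZ /=; congr (_ * _).
rewrite (coef_right hW) ?mul1g ?len1 ?si //; last exact: (parabolic1 hW).
rewrite coefT //; have swV : (len (s i * w) = len (w^-1 * s i))%g.
  by rewrite -(lenV hW) invgM (simpleV hW).
have Isw : WI (s i * w)%g by exact: parabolicM.
have E : ((s i * w)%g == 1%g) = (w == s i).
  apply/eqP/eqP => [E|->]; last exact: (simpleK hW).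
  by rewrite -[w]mul1g -(simpleK hW i) -mulgA E mulg1.
have [up|] := boolP (len w < len (s i * w)%g)%N.
  rewrite (ph_up hT) // coefT // E.
  have /negPf-> : w != s i; last by rewrite mulr0.
  by apply: contraTneq up => ->; rewrite (simpleK hW) len1 si.
rewrite swV -(lenV hW w) (len_simple_ltn hW) negbK -swV (lenV hW) => down.
rewrite (ph_down hT) // linearD !linearZ /= !coefT // E.
have /negPf-> : w != 1%g by apply: contraTneq down => ->; rewrite len1.
by rewrite scaler0 add0r.
Qed.

(** By linearity and the factorisation of [T w] it suffices to move one generator across at a
    time. *)
Lemma coef1C a b : coef 1%g (a * b) = coef 1%g (b * a) :> R.
Proof.
have [r [_ rI ->]] := coef_expand hT a.
rewrite mulr_suml mulr_sumr !linear_sum; apply: eq_big_seq => w /rI Iw.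
rewrite -scalerAl -scalerAr !linearZ /=; congr (_ * _).
have [u [uI _ ->]] := parabolic_hecke_prod hW hT (fintype.subxx I) Iw.
elim: u b uI => [|i u IHu] b uI; first by rewrite big_nil mul1r mulr1.
rewrite big_cons -mulrA coef1_simple ?uI ?mem_head // -mulrA IHu ?mulrA //.
by move=> j ju; apply: uI; rewrite inE ju orbT.
Qed.

Lemma hecke_parabolic_inj v w : WI v -> WI w -> T v = T w -> v = w.
Proof.
move=> Iv Iw /(congr1 (fun a => coef w a : R)); rewrite !coefT // eqxx.
by case: eqP => // _ /eqP; rewrite eq_sym oner_eq0.
Qed.

Lemma euler_traceE : euler_trace (T @` WI) = (fun a => coef 1%g a : R).
Proof.
have I1 : WI 1%g by exact: (parabolic1 hW).
apply: xget_unique => [|f [f_lin f1 f0]].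
  split=> [c a b|| _ [w Iw <-]]; first by rewrite linearP.
    by rewrite -(ph_one hT) coefT ?eqxx.
  move=> Tw1; rewrite coefT //; suff /negPf-> : w != 1%g by [].
  by apply: contraNneq Tw1 => ->; rewrite (ph_one hT).
have fD a b : f (a + b) = f a + f b by rewrite -[a]scale1r f_lin mul1r scale1r.
have f00 : f 0 = 0 by apply: (addrI (f 0)); rewrite -fD !addr0.
have fZ c a : f (c *: a) = c * f a by rewrite -[c *: a]addr0 f_lin f00 addr0.
apply/funext => a; have [r [_ rI ->]] := coef_expand hT a.
rewrite linear_sum (big_morph f fD f00); apply: eq_big_seq => w /rI Iw.
rewrite linearZ /= fZ coefT //; congr (_ * _).
have [->|w1] := eqVneq w 1%g; first by rewrite (ph_one hT).
apply: f0; first by exists w.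
by apply: contraNneq w1 => E; apply/eqP/hecke_parabolic_inj => //;
  rewrite (ph_one hT).
Qed.

Hypothesis hq : forall J : {set S}, J \subset I -> spherical s J ->
  invertible (eval_int q (poincare_poly s J)).

Definition poincare_inv (J : {set S}) : R :=
  xget 0 [set y | eval_int q (poincare_poly s J) * y = 1].

Lemma poincare_invP (J : {set S}) : J \subset I -> spherical s J ->
  eval_int q (poincare_poly s J) * poincare_inv J = 1.
Proof. by move=> JI /(hq JI); exact: xgetPex. Qed.

Lemma eval_poincare_poly (J : {set S}) :
  eval_int q (poincare_poly s J) = \sum_(u <- fset_set (parabolic s J)) q ^+ len u.
Proof.
rewrite /eval_int /poincare_poly rmorph_sum horner_sum; apply: eq_bigr => u _.
by rewrite rmorphXn /= map_polyX hornerXn.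
Qed.

Definition euler_term (J : {set S}) : R :=
  if `[< spherical s J >] then q ^+ len (longest s J) * poincare_inv J else 0.

(** With [v = w_J u] this is [1 / p_J(q)] times the sum of [(-1)^(len v) q^(N_J - len v) T_v] over
    [W_J]: the idempotent of the sign representation, written without inverting [q]. *)
Definition anti_idem (J : {set S}) : A :=
  if `[< spherical s J >]
  then ((-1) ^+ len (longest s J) * poincare_inv J) *: alternating s q T J (longest s
    J)
  else 0.

Lemma anti_parabolic (J : {set S}) a w : J \subset I -> anti J a -> parabolic s J w ->
  a * T w = (-1) ^+ len w *: a.
Proof.
move=> JI Ja /(parabolic_hecke_prod hW hT JI)[u [uJ <- ->]].
elim: u a Ja uJ => [|i u IHu] a Ja uJ; first by rewrite big_nil mulr1 scale1r.
rewrite big_cons mulrA Ja ?uJ ?mem_head // mulNr IHu //; last first.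
  by move=> j ju; apply: uJ; rewrite inE ju orbT.
by rewrite exprS mulN1r scaleNr.
Qed.

Lemma anti_anti_idem (J : {set S}) : J \subset I -> anti J (anti_idem J).
Proof.
move=> JI; rewrite /anti_idem; case: asboolP => [sphJ|_]; last exact: anti0.
have [Jl Dl] := longestP hW sphJ; apply: antiZ => i iJ.
exact: (alternating_anti hW hT JI (parabolicS hW JI Jl)).
Qed.

(** By [anti_span] such an [a] is a combination of elements indexed by some [w] descending under
    [J], and there is none when [W_J] is infinite. *)
Lemma anti_nonspherical (J : {set S}) a : J \subset I -> ~ spherical s J -> anti J a
  -> a = 0.
Proof.
move=> JI nsphJ /(anti_span hW hT JI)[r [rD ->]]; rewrite big_seq big1 // => u /rD[_].
by rewrite -(descendsE s _ JI) => /(descends_spherical hW).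
Qed.

(** On [P_J] each [T_w] with [w] in [W_J] acts by [(-1)^(len w)], so the alternating element acts by
    [(-1)^N_J p_J(q)], which the normalisation cancels. With [anti_anti_idem] this gives
    [P_J = A e_J] and the idempotence of [e_J]. *)
Lemma mul_anti_idem (J : {set S}) a : J \subset I -> anti J a -> a * anti_idem J = a.
Proof.
move=> JI Ja; rewrite /anti_idem; case: asboolP => [sphJ|nsphJ]; last first.
  by rewrite (anti_nonspherical JI nsphJ Ja) mul0r.
have [Jl Dl] := longestP hW sphJ; have Il := parabolicS hW JI Jl.
rewrite -scalerAr.
have -> : a * alternating s q T J (longest s J) =
    ((-1) ^+ len (longest s J) * eval_int q (poincare_poly s J)) *: a.
  rewrite eval_poincare_poly mulr_sumr mulr_sumr scaler_suml;
    apply: eq_big_seq => u Ju.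
  have lu := len_coset hW Dl Ju; rewrite (mem_parabolic hW Dl) in Ju;
    move/asboolP in Ju.
  rewrite -scalerAr (anti_parabolic JI Ja) ?scalerA; last exact: parabolicM.
  by rewrite -lu exprD [(- q) ^+ _]exprNn mulrC mulrA.
rewrite scalerA mulrACA -expr2 sqrr_sign mul1r [X in X *: _]mulrC poincare_invP //.
exact: scale1r.
Qed.

(** Only [u = w_J^-1] yields [T_1]; its coefficient [(-q)^N_J] loses its sign to the
    normalisation. *)
Lemma coef1_anti_idem (J : {set S}) : J \subset I ->
  coef 1%g (anti_idem J) = euler_term J :> R.
Proof.
move=> JI; rewrite /anti_idem /euler_term; case: asboolP => [sphJ|_];
  last by rewrite linear0.
have [Jl Dl] := longestP hW sphJ; have Il := parabolicS hW JI Jl.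
have lV : (longest s J)^-1%g \in fset_set (parabolic s J).
  by rewrite (mem_parabolic hW Dl); apply/asboolP; exact: parabolicV.
rewrite linearZ linear_sum (bigD1_seq _ lV) ?fset_uniq //= big_seq_cond big1;
  last first.
  move=> u /andP[Ju uV]; rewrite linearZ /= coefT;
    last exact: (parabolic_coset hW JI Il Dl Ju).
  have /negPf-> : (longest s J * u)%g != 1%g; last exact: mulr0.
  by apply: contraNneq uV => /mulg1_eq->.
rewrite addr0 linearZ /= mulgV coefT ?eqxx; last exact: (parabolic1 hW).
by rewrite (lenV hW) /GRing.scale /= mulr1 mulrAC [(- q) ^+ _]exprNn mulrA -expr2
  sqrr_sign mul1r.
Qed.

(** Each [b_w] with [w != 1] is assigned to one chosen descent of [w]. The resulting projections,
    linear over [R], split the span of these [b_w] and serve as [rho] in the Koszul homotopy. *)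
Definition alt_proj (i : S) : {linear A -> A} :=
  projT1 (cid (fam_ext (fun w => if [pick j in descents w] == Some i
                                 then alt_basis s q I T w else 0) (alt_basisP hW
                                   hT))).

Lemma alt_projE i w : WI w -> alt_proj i (alt_basis s q I T w) =
  if [pick j in descents w] == Some i then alt_basis s q I T w else 0.
Proof. by move=> Iw; rewrite /alt_proj; case: cid => F /= ->. Qed.

Lemma alt_proj_anti (J : {set S}) i a : J \subset I -> anti J a -> anti (i |: J)%SET
  (alt_proj i a).
Proof.
move=> JI /(anti_span hW hT JI)[r [rD ->]]; rewrite linear_sum;
  apply: anti_sum => u /rD[Iu JD] _.
rewrite linearZ /= alt_projE //; apply: antiZ; case: eqP => [Ei|_]; last exact: anti0.
apply: (anti_alt_basis hW hT Iu); apply/fintype.subsetP => j; rewrite in_setU1.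
case/orP => [/eqP->|/(fintype.subsetP JD)//].
by move: Ei; case: pickP => // k kD [<-].
Qed.

Lemma alt_proj_out i a : i \notin I -> alt_proj i a = 0.
Proof.
move=> iI; have [r [rI ->]] := (alt_basisP hW hT).1 a;
  rewrite linear_sum big_seq big1 // => u ur.
rewrite linearZ /= alt_projE; last exact: rI.
case: pickP => [k kD|_]; last by rewrite scaler0.
case: eqP => [[ki]|_]; last by rewrite scaler0.
by move: kD; rewrite /= ki inE (negPf iI).
Qed.

Lemma sum_alt_proj_basis w : WI w ->
  \sum_i alt_proj i (alt_basis s q I T w) =
  if descents w == finset.set0 then 0 else alt_basis s q I T w.
Proof.
move=> Iw; under eq_bigr => i _ do rewrite alt_projE //.
case: pickP => [k kD|D0].
  have /negPf-> : descents w != finset.set0 by apply/finset.set0Pn; exists k.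
  rewrite (bigD1 k) //= eqxx big1 ?addr0 // => i /negPf ik.
  by case: eqP => // -[ki]; rewrite ki eqxx in ik.
rewrite big1 //; suff -> : descents w = finset.set0 by rewrite eqxx.
by apply/setP => i; rewrite [LHS]D0 inE.
Qed.

Lemma alt_basis1 : alt_basis s q I T 1%g = 1.
Proof.
have I1 : WI 1%g by exact: (parabolic1 hW).
have D1 := descends_descents s I 1%g.
rewrite /alt_basis /alternating (bigD1_seq 1%g) ?fset_uniq //=; last first.
  by rewrite (mem_parabolic hW D1); apply/asboolP; exact: (parabolic1 hW).
rewrite len1 expr0 scale1r mulg1 (ph_one hT) big_seq_cond big1 ?addr0 // => u
  /andP[Du u1].
have := len_coset hW D1 Du; rewrite mul1g len1 => /eqP;
  rewrite addn_eq0 => /andP[/eqP/(len_eq0 hW) uE _].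
by rewrite uE eqxx in u1.
Qed.

(** Only [w = 1] has no descents, so the projections together miss just the multiples of
    [b_1 = 1]. *)
Lemma alt_proj_sum a : exists c : R, a = c *: 1 + \sum_i alt_proj i a.
Proof.
have [r [rI ->]] := (alt_basisP hW hT).1 a.
exists (\sum_(u <- r | descents u.2 == finset.set0) u.1).
under [X in _ = _ + X]eq_bigr => i _ do rewrite linear_sum.
rewrite [X in _ = _ + X]exchange_big scaler_suml /= [X in X + _]big_mkcond -big_split.
apply: eq_big_seq => u /rI Iu /=; under [X in _ = _ + X]eq_bigr => i _ do rewrite
  linearZ /=.
rewrite -scaler_sumr sum_alt_proj_basis //; case: eqP => [/(descents_eq0 hW Iu)->|_].
  by rewrite scaler0 addr0 alt_basis1.
by rewrite add0r.
Qed.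

Lemma alt_proj_sum_anti (J : {set S}) a : J \subset I -> J != finset.set0 -> anti J a
  ->
  \sum_i alt_proj i a = a.
Proof.
move=> JI J0 /(anti_span hW hT JI)[r [rD ->]].
under eq_bigr => i _ do rewrite linear_sum.
rewrite exchange_big; apply: eq_big_seq => u /rD[Iu JD] /=.
under eq_bigr => i _ do rewrite linearZ /=.
rewrite -scaler_sumr sum_alt_proj_basis //; case: eqP => // D0.
by move: JD J0; rewrite D0 finset.subset0 => ->.
Qed.

Section Resolution.
Variable eps : {lrmorphism A -> R | *%R}.
Hypothesis epsT : forall w, WI w -> eps (T w) = q ^+ len w.

(** Zero outside the [k]-element subsets of [I], so that every term of the complex consists of
    families over all of [{set S}] and the Koszul formulas apply to it directly. *)
Definition cell_idem k (J : {set S}) : A :=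
  if (#|J| == k) && (J \subset I) then anti_idem J else 0.

Lemma cell_idem_idem k J : cell_idem k J * cell_idem k J = cell_idem k J.
Proof.
rewrite /cell_idem; case: ifP => [/andP[_ JI]|_]; last exact: mulr0.
by rewrite mul_anti_idem //; exact: anti_anti_idem.
Qed.

Definition cell k : lmodType A := idem_sum (cell_idem k).

Lemma cell_anti k (x : cell k) (J : {set S}) : anti J (x J : A).
Proof.
have := idem_sumK x J; rewrite /cell_idem; case: ifP => [/andP[_ JI] <-|_ <-].
  by apply: antiM; exact: anti_anti_idem.
by rewrite mulr0; exact: anti0.
Qed.

Lemma cell_out k (x : cell k) (J : {set S}) : ~~ ((#|J| == k) && (J \subset I)) -> x
  J = 0.
Proof.
by move=> /negPf Jk; have := idem_sumK x J; rewrite /cell_idem Jk mulr0 => <-.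
Qed.

Lemma cell_idemK k (f : {set S} -> A) :
  (forall J : {set S}, #|J| = k -> J \subset I -> anti J (f J)) ->
  (forall J : {set S}, ~~ ((#|J| == k) && (J \subset I)) -> f J = 0) ->
  forall J, f J * cell_idem k J = f J.
Proof.
move=> f1 f2 J; rewrite /cell_idem; case: ifP => [/andP[/eqP Jk JI]|/negbT/f2->].
  by rewrite mul_anti_idem //; exact: f1.
exact: mulr0.
Qed.

(** The differential lands in [P_J] because [P_(i |: J)] is contained in [P_J]. *)
Lemma cell_diff_subproof k (x : cell k.+1) (J : {set S}) :
  koszul_diff (fun K => x K : A) J * cell_idem k J = koszul_diff (fun K => x K : A) J.
Proof.
apply: (cell_idemK (f := koszul_diff (fun K => x K : A))) => {}J.
  move=> _ _; apply: anti_sum => i _ _; apply: antiZ.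
  apply: (antiS (J := (i |: J)%SET)); [exact: finset.subsetUr|exact: cell_anti].
move=> Jk; rewrite /koszul_diff big1 // => i iJ; rewrite cell_out ?scaler0 //.
by apply: contra Jk; rewrite cardsU1 iJ add1n eqSS => /andP[->] /=;
  apply/fintype.subset_trans/finset.subsetUr.
Qed.

Definition cell_diff_fun k (x : cell k.+1) : cell k := mk_idem (cell_diff_subproof x).

Lemma cell_diffE k x J : @cell_diff_fun k x J = koszul_diff (fun K => x K : A) J.
Proof. exact: mk_idemE. Qed.

Lemma cell_diff_linear k : linear (@cell_diff_fun k).
Proof.
move=> a x y; apply: idem_sum_eq => J; rewrite idem_sumD idem_sumZ !cell_diffE.
rewrite /koszul_diff mulr_sumr -big_split; apply: eq_bigr => i _.
by rewrite idem_sumD idem_sumZ scalerDr scalerAr.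
Qed.

Definition cell_diff k : {linear cell k.+1 -> cell k} := mk_linear (@cell_diff_linear
  k).

Definition cell_aug_fun (x : cell 0) : index_module eps := eps (x finset.set0).

Lemma cell_aug_linear : linear cell_aug_fun.
Proof.
move=> a x y; rewrite /cell_aug_fun idem_sumD idem_sumZ.
rewrite [LHS](raddfD eps); congr (_ + _); exact: (rmorphM eps).
Qed.

Definition cell_aug : {linear cell 0 -> index_module eps} := mk_linear
  cell_aug_linear.

(** The homotopy lands in [P_J] because [alt_proj i] maps [P_(J :\ i)] into [P_J]. *)
Lemma cell_homotopyK k (x : cell k) (J : {set S}) :
  koszul_homotopy alt_proj (fun K => x K : A) J * cell_idem k.+1 J =
  koszul_homotopy alt_proj (fun K => x K : A) J.
Proof.
apply: (cell_idemK (f := koszul_homotopy alt_proj (fun K => x K : A))) => {}J.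
  move=> _ JI; apply: anti_sum => i _ iJ; apply: antiZ;
    rewrite -{1}(finset.setD1K iJ).
  apply: alt_proj_anti; last exact: cell_anti.
  exact: fintype.subset_trans (finset.subsetDl _ _) JI.
move=> Jk; rewrite /koszul_homotopy big1 // => i iJ.
have [iI|iI] := boolP (i \in I); last by rewrite alt_proj_out ?scaler0.
rewrite cell_out ?linear0 ?scaler0 //; apply: contra Jk => /andP[/eqP Jk JI].
rewrite (cardsD1 i) iJ Jk add1n eqxx /= -(finset.setD1K iJ).
by apply/fintype.subsetP => j; rewrite in_setU1 => /orP[/eqP->|/(fintype.subsetP JI)].
Qed.

Lemma cell_contract k (x : cell k) :
  exists y : cell k.+1, forall J : {set S},
    cell_diff k y J = \sum_i alt_proj i (x J) - koszul_homotopy alt_proj (koszul_diff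
      (fun K => x K : A)) J.
Proof.
exists (mk_idem (cell_homotopyK x)) => J.
rewrite -koszul_homotopyP addrK -[cell_diff k _]/(cell_diff_fun _) cell_diffE.
by apply: eq_bigr => i _; rewrite mk_idemE.
Qed.

Lemma koszul_homotopy0 (x : {set S} -> A) J : x =1 (fun=> 0) -> koszul_homotopy
  alt_proj x J = 0.
Proof. by move=> x0; rewrite /koszul_homotopy big1 // => i _;
  rewrite x0 linear0 scaler0. Qed.

(** On a cycle the second term of [cell_contract] vanishes, and the projections sum to the identity
    on [P_J] since [J] has [k + 1] elements and so is not empty. *)
Lemma cell_exact k (x : cell k.+1) :
  cell_diff k x = 0 <-> exists y, cell_diff k.+1 y = x.
Proof.
split=> [dx0|[y <-]]; last first.
  apply: idem_sum_eq => J; rewrite -[cell_diff k _]/(cell_diff_fun _) cell_diffE.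
  transitivity (koszul_diff (koszul_diff (fun K => y K : A)) J);
    last by rewrite koszul_diffK ffunE.
  by apply: eq_bigr => i _; rewrite cell_diffE.
have [y yE] := cell_contract x; exists y; apply: idem_sum_eq => J; rewrite yE.
rewrite koszul_homotopy0 ?subr0 => [|K]; last by rewrite -cell_diffE [cell_diff_fun
  _]dx0 ffunE.
have [/andP[/eqP Jk JI]|Jk] := boolP ((#|J| == k.+1) && (J \subset I)).
  by apply: (alt_proj_sum_anti JI); [rewrite -cards_eq0 Jk|exact: cell_anti].
by rewrite cell_out // big1 // => i _; rewrite linear0.
Qed.

(** Applying [eps] gives [(1 + q) eps a = 0], and [1 + q] is the invertible Poincaré value of the
    subgroup generated by [s i]. *)
Lemma eps_anti i a : i \in I -> a * T (s i) = - a -> eps a = 0.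
Proof.
move=> iI aT; have aE : eps a * eps (T (s i)) = - eps a by rewrite -rmorphM aT
  rmorphN.
rewrite epsT in aE; last exact: parabolic_simple.
rewrite (len_simple hW) expr1 in aE.
have set1_sub : [set i]%SET \subset I by rewrite finset.sub1set.
have [y yE] := hq (J := [set i]%SET) set1_sub (parabolic_set1_spherical hW i).
move: yE; rewrite eval_poincare_poly (parabolic_set1_sum hW) len1 (len_simple hW)
  expr0 expr1 => yE.
by rewrite -[eps a]mulr1 -yE mulrA mulrDr mulr1 aE subrr mul0r.
Qed.

(** At the empty set the projections miss a multiple [c] of [1]. As [eps] kills their images, [c] is
    the augmentation of [x], so it vanishes exactly on the kernel. *)
Lemma cell_exact0 (x : cell 0) : cell_aug x = 0 <-> exists y, cell_diff 0 y = x.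
Proof.
have alt0 (a : A) : eps (\sum_i alt_proj i a) = 0.
  rewrite raddf_sum big1 // => i _; have [iI|iI] := boolP (i \in I); last first.
    by rewrite alt_proj_out // raddf0.
  apply: (eps_anti iI); have /(_ i) : anti (i |: finset.set0)%SET (alt_proj i a).
    by apply: alt_proj_anti; [exact: finset.sub0set|move=> j; rewrite inE].
  by apply; rewrite !inE eqxx.
split=> [x0|[y <-]]; last first.
  change (eps (cell_diff_fun y finset.set0) = 0);
    rewrite cell_diffE raddf_sum big1 // => i _.
  rewrite [LHS](linearZ_LR eps) /=; have [iI|iI] := boolP (i \in I); last first.
    rewrite cell_out ?raddf0 ?mulr0 //; apply: contra iI => /andP[_
      /fintype.subsetP]; apply.
    by rewrite !inE eqxx.
  rewrite (eps_anti iI) ?mulr0 //; apply: (cell_anti y (J := (i |: finset.set0)%SET)).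
  by rewrite !inE eqxx.
have [y yE] := cell_contract x; exists y; apply: idem_sum_eq => J; rewrite yE.
rewrite koszul_homotopy0 ?subr0 => [|K]; last first.
  rewrite /koszul_diff big1 // => i iK; rewrite cell_out ?scaler0 //.
  by rewrite cardsU1 iK.
have [->|J0] := eqVneq J finset.set0; last first.
  by rewrite cell_out ?cards_eq0 ?(negPf J0) // big1 // => i _; rewrite linear0.
have [c E] := alt_proj_sum (x finset.set0 : A).
have : eps (x finset.set0) = 0 by exact: x0.
rewrite {1}E raddfD /= alt0 addr0 linearZ rmorph1 /= mulr1 => c0.
by rewrite [RHS]E c0 scale0r add0r.
Qed.

Definition cell_resolution : fp_resolution (index_module eps).
Proof.
apply: (@FPResolution A (index_module eps) #|S| cell cell_diff cell_aug).
- by move=> k; apply: dual_basis_fg (idem_dual_basis (cell_idem_idem k)).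
- by move=> k; apply: dual_basis_projective (idem_dual_basis (cell_idem_idem k)).
- move=> k lt_k x; apply: idem_sum_eq => J; rewrite cell_out ?ffunE //.
  rewrite negb_and; apply/orP; left; apply: contraTneq lt_k => <-.
  by rewrite -leqNgt max_card.
- move=> y.
  (* In degree zero the only summand is [P_J = A] for empty [J], and [y] is the image of [y] times
     the unit. *)
  have yP : forall J : {set S},
      (if J == finset.set0 then y%:A else 0) * cell_idem 0 J = if J == finset.set0
        then (y : R)%:A else 0.
    apply: cell_idemK => J; first by move=> /eqP; rewrite cards_eq0 => /eqP-> _ i;
      rewrite inE.
    by rewrite cards_eq0; case: eqP => // ->; rewrite finset.sub0set.
  exists (mk_idem yP); change (eps (mk_idem yP finset.set0) = y);
    rewrite mk_idemE eqxx.
  by rewrite [LHS](linearZ_LR eps) rmorph1 /= mulr1.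
- exact: cell_exact0.
- exact: cell_exact.
Defined.

Lemma parabolic_is_euler : is_euler_algebra (T @` WI) eps.
Proof.
split; first exact/fam_basis_image/(ph_basis hT).
- by exists 1%g; [exact: (parabolic1 hW)|exact: (ph_one hT)].
- exact: inhabits cell_resolution.
- by move=> x y; rewrite euler_traceE coef1C.
Qed.

Lemma parabolic_euler_char :
  euler_char (T @` WI) eps = \sum_(J : {set S} | J \subset I) (-1) ^+ #|J| *
    euler_term J.
Proof.
rewrite /euler_char /euler_mu euler_traceE.
pose t k : seq ({linear res_mod cell_resolution k -> A^o} * res_mod cell_resolution
  k) :=
  idem_dual (cell_idem_idem k).
have tP k : dual_basis (t k) by exact: idem_dual_basis.
rewrite (hs_rank_trace (tau := coef 1%g) coef1C tP (leqnn _)).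
transitivity (\sum_(k < #|S|.+1) \sum_(J : {set S}) (coef 1%g (cell_idem k J) : R) *
  (-1) ^+ k).
  apply: eq_bigr => k _; rewrite [X in X *~ _](idem_dual_trace (cell_idem_idem k)).
  rewrite -mulr_suml -mulrzr; congr (_ * _); by rewrite rmorphXn rmorphN1.
(* Each [J] contributes in the single degree [#|J|], which is at most [#|S|]. *)
rewrite exchange_big [RHS]big_mkcond; apply: eq_bigr => J _ /=.
have ltJ : (#|J| < #|S|.+1)%N by rewrite ltnS max_card.
rewrite (bigD1 (Ordinal ltJ)) //= big1 => [|k kJ]; last first.
  rewrite /cell_idem; case: eqP => [E|_]; last by rewrite linear0 mul0r.
  by case/eqP: kJ; apply: val_inj.
rewrite addr0 /cell_idem eqxx /=; case: ifP => [JI|_]; last by rewrite linear0 mul0r.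
by rewrite coef1_anti_idem // mulrC.
Qed.

End Resolution.

End EulerCharacteristic.

(** * Poincare series *)

Section SubsetSums.
Variables (R : comNzRingType) (S : finType).
Implicit Types (D I J : {set S}) (f : {set S} -> R).

(** Expand the product over [D] of the factors [-1 + 1]. *)
Lemma alternating_sum_subsets D :
  \sum_(J : {set S} | J \subset D) (-1) ^+ #|J| = (D == finset.set0)%:R :> R.
Proof.
have := bigA_distr 1 +%R (fun i : S => if i \in D then -1 else 0 : R) (fun=> 1).
have -> : \prod_i ((if i \in D then -1 else 0) + 1) = (D == finset.set0)%:R :> R.
  have [->|] := eqVneq D finset.set0; first by rewrite big1 // => i _;
    rewrite inE add0r.
  by move=> /finset.set0Pn[i iD]; rewrite (bigD1 i) //= iD addNr mul0r.
move=> ->; rewrite big_mkcond; apply: eq_bigr => J _.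
case: ifP => [JD|/negbT/fintype.subsetPn[i iJ iD]]; last first.
  by rewrite (bigD1 i) //= iJ (negPf iD) mul0r.
rewrite -big_mkcond -prodr_const; apply: eq_bigr => i iJ.
by rewrite (fintype.subsetP JD).
Qed.

(** For [J] proper, the complements of the admissible [I] are the non-empty subsets of the
    complement of [J]; their alternating sum is [-1], so [f J] gets the coefficient [1]. *)
Lemma proper_inclusion_exclusion f : f [set: S]%SET = 0 ->
  \sum_(I : {set S} | I \proper [set: S]%SET)
     (-1) ^+ (#|~: I|%SET - 1) * \sum_(J : {set S} | J \subset I) f J =
  \sum_J f J.
Proof.
move=> fS0; under eq_bigr => I _ do rewrite mulr_sumr.
rewrite (exchange_big_dep xpredT) //=; apply: eq_bigr => J _; rewrite -mulr_suml.
have [->|JS] := eqVneq J [set: S]%SET; first by rewrite fS0 mulr0.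
suff -> : \sum_(I : {set S} | (I \proper [set: S]%SET) && (J \subset I)) (-1) ^+
  (#|~: I|%SET - 1) = 1 :> R.
  by rewrite mul1r.
have := alternating_sum_subsets (~: J)%SET.
rewrite (bigD1 finset.set0) ?finset.sub0set //= cards0 expr0.
have /negPf-> : (~: J)%SET != finset.set0 by apply: contraNneq JS => E;
  rewrite -[J]finset.setCK E finset.setC0.
move=> /eqP; rewrite addr_eq0 => /eqP E; rewrite [RHS]E -sumrN {E}.
rewrite (reindex_inj (@finset.setC_inj S)) /=; apply: eq_big => [I|I].
  rewrite finset.properEneq finset.subsetT andbT [J \subset _]finset.subsetC andbC.
  by rewrite -finset.setC0 (inj_eq (@finset.setC_inj S)).
(* The set is non-empty, so the truncated subtraction in the exponent is exact. *)
rewrite finset.setCK => /andP[IS _]; have I0 : (0 < #|I|)%N.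
  rewrite card_gt0; apply: contraTneq IS => ->.
  by rewrite finset.setC0 fintype.properxx.
by rewrite subn1 -[in RHS](prednK I0) exprS mulN1r opprK.
Qed.

End SubsetSums.

(** * Formal power series *)

Section FormalSeries.
Variable R : comNzRingType.
Implicit Types (f g : fps R) (p : {poly R}).

Lemma fps_sumE (K : Type) (r : seq K) (P : pred K) (F : K -> fps R) n :
  (\sum_(k <- r | P k) F k) n = \sum_(k <- r | P k) F k n.
Proof. by elim/big_rec2: _ => // k x y _ <-. Qed.

Lemma fps_mulE f g n : (f * g) n = \sum_(i < n.+1) f i * g (n - i)%N.
Proof. by []. Qed.

Lemma fps_of_poly_is_additive : additive (@fps_of_poly R).
Proof. by move=> p p'; apply/funext => n; rewrite /fps_of_poly coefB. Qed.

HB.instance Definition _ := GRing.isZmodMorphism.Build {poly R} (fps R) (@fps_of_poly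
  R)
  fps_of_poly_is_additive.

Lemma fps_of_poly_is_multiplicative : GRing.monoid_morphism (@fps_of_poly R).
Proof. by split=> // p p'; exact: fps_of_polyM. Qed.

HB.instance Definition _ := GRing.isMonoidMorphism.Build {poly R} (fps R)
  (@fps_of_poly R)
  fps_of_poly_is_multiplicative.

Lemma fps_of_poly_signM k p : fps_of_poly ((-1) ^+ k * p) = (-1) ^+ k * fps_of_poly p.
Proof. by rewrite rmorphM rmorphXn rmorphN1. Qed.

Lemma fps_signE k f n : ((-1) ^+ k * f) n = (-1) ^+ k * f n.
Proof.
elim: k => [|k IHk]; first by rewrite !expr0 !mul1r.
by rewrite !exprS !mulN1r !mulNr -IHk.
Qed.

Lemma fps_mulXn f k n : (f * fps_of_poly 'X^k) n = if (k <= n)%N then f (n - k)%N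
  else 0.
Proof.
rewrite mulrC fps_mulE /fps_of_poly; case: leqP => [le_kn|lt_nk].
  have lt_k : (k < n.+1)%N by [].
  rewrite (bigD1 (Ordinal lt_k)) //= coefXn eqxx mul1r big1 ?addr0 // => i ik.
  rewrite coefXn; case: eqP => [E|_]; last by rewrite mul0r.
  by case/eqP: ik; apply: val_inj.
rewrite big1 // => i _; rewrite coefXn; case: eqP => [E|_]; last by rewrite mul0r.
by have := ltn_ord i; rewrite E ltnS leqNgt lt_nk.
Qed.

(** Geometric series in [h = 1 - f]: the power [h^k] vanishes below degree [k], so the coefficient
    of degree [n] involves only the powers up to [n]. *)
Lemma fps_invertible f : f 0%N = 1 -> invertible f.
Proof.
move=> f0; pose h := 1 - f.
have h0 : h 0%N = 0.
  by change ((1 : {poly R})`_0 - f 0%N = 0); rewrite coef1 f0 subrr.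
have hk k n : (n < k)%N -> (h ^+ k) n = 0.
  elim: k n => // k IHk n lt_nk; rewrite exprS fps_mulE big1 // => i _.
  case: i => -[|i] /= lt_in; first by rewrite h0 mul0r.
  by rewrite IHk ?mulr0 //; lia.
exists (fun n => \sum_(k < n.+1) (h ^+ k) n); apply/funext => n.
transitivity ((f * \sum_(k < n.+1) h ^+ k) n).
  rewrite !fps_mulE; apply: eq_bigr => i _; congr (_ * _); rewrite fps_sumE.
  have le_in : ((n - i).+1 <= n.+1)%N by rewrite ltnS leq_subr.
  rewrite (big_ord_widen _ (fun k => (h ^+ k) (n - i)%N) le_in) big_mkcond.
  apply: eq_bigr => k _; case: ltnP => // lt_k; exact/esym/hk.
have -> : f * \sum_(k < n.+1) h ^+ k = 1 - h ^+ n.+1.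
  by rewrite -opprB subrX1 /h addrAC subrr add0r mulNr opprK.
by change ((1 : fps R) n - (h ^+ n.+1) n = (1 : fps R) n); rewrite hk // subr0.
Qed.

End FormalSeries.

Lemma eval_int_fpsX (p : {poly int}) :
  eval_int (fpsX int) p = fps_of_poly p.
Proof.
rewrite /eval_int; elim/poly_ind: p => [|p c IHp]; first by rewrite !rmorph0 horner0.
rewrite !rmorphD !rmorphM /= map_polyX map_polyC /= hornerMXaddC IHp; congr (_ + _).
by rewrite -[c in RHS]intz !rmorph_int.
Qed.

(** * Descent classes and the inverse of the Poincaré series *)

Section Poincare.
Variables (W : groupType) (S : finType) (m : S -> S -> option nat) (s : S -> W).
Hypothesis hW : coxeter_system m s.
Local Notation len := (len s).

(** The shift [k] describes coefficients of series multiplied by [X^k] without truncated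
    subtraction. *)
Definition sphere k n : {fset W} := fset_set [set w | (len w + k)%N = n].

Lemma mem_sphere k n w : (w \in sphere k n) = ((len w + k)%N == n).
Proof.
rewrite in_fset_set ?inE; first by apply/asboolP/eqP.
by apply: sub_finite_set (finite_ball hW n) => v /= <-; rewrite leq_addr.
Qed.

Definition sphere_count (P : pred W) : fps int := fun n => (count P (sphere 0 n))%:Z.

Lemma sphere_count_mulXn P k n :
  (sphere_count P * fps_of_poly 'X^k) n = (count P (sphere k n))%:Z.
Proof.
rewrite fps_mulXn /sphere_count; case: leqP => [le_kn|lt_nk].
  have -> : sphere 0 (n - k) = sphere k n; last by [].
  by apply/fsetP => w; rewrite !mem_sphere addn0; lia.
suff /eqP -> : count P (sphere k n) == 0%N by [].
rewrite -leqn0 leqNgt -has_count; apply/hasP => -[w]; rewrite mem_sphere => /eqP; lia.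
Qed.

Lemma poincare_seriesE : poincare_series s setT = sphere_count predT.
Proof.
apply/funext => n; rewrite /poincare_series /sphere_count count_predT; congr (_%:Z).
have -> // : [set w | setT w /\ len w = n] = [set w | (len w + 0)%N = n].
by apply/seteqP; split=> w /=; rewrite addn0 => // -[].
Qed.

(* Every coset of [W_J] contains exactly one element [w] with [J] among its
   right descents, and [w] is the longest element of the coset. *)
Lemma poincare_coset (J : {set S}) : spherical s J ->
  poincare_series s setT * fps_of_poly 'X^(len (longest s J)) =
  sphere_count (descends s J) * fps_of_poly (poincare_poly s J).
Proof.
move=> sphJ; have [Jl Dl] := longestP hW sphJ; set l := longest s J in Jl Dl *.
have memJ u := mem_parabolic hW Dl u.
have lenJ v : parabolic s J v -> (len v + len (l^-1 * v)%g)%N = len l.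
  move=> Jv; rewrite -(len_descents hW (descendsP _ _ _ Dl) (y := (l^-1 * v)%g)).
    by rewrite mulgA mulgV mul1g.
  by apply: parabolicM => //; exact: parabolicV.
apply/funext => n; rewrite poincare_seriesE sphere_count_mulXn /poincare_poly.
rewrite raddf_sum mulr_sumr fps_sumE.
under eq_bigr => v _ do rewrite sphere_count_mulXn.
(* [Q v z] says that [z = w l^-1 v] with [w] the longest element of the coset [z W_J]; every [z]
   satisfies it for exactly one [v] in [W_J]. *)
pose Q v z := descends s J (z * (v^-1 * l))%g.
have -> : count predT (sphere (len l) n) =
    (\sum_(v <- fset_set (parabolic s J)) count (Q v) (sphere (len l) n))%N.
  under eq_bigr => v _ do rewrite -sum1_count big_mkcond.
  rewrite exchange_big -sum1_count; apply: eq_bigr => z _ /=.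
  have [u Ju Dzu] := coset_descends hW z sphJ.
  have Jv : parabolic s J (l * u^-1)%g by apply: parabolicM => //; exact: parabolicV.
  rewrite (bigD1_seq (l * u^-1)%g) ?fset_uniq //=; last by rewrite memJ;
    apply/asboolP.
  rewrite /Q invgM invgK mulgVK Dzu big_seq_cond big1 // => v /andP[]; rewrite memJ.
  move=> /asboolP Jv' vlu; case: ifP => // Dzv; case/eqP: vlu.
  have : (u^-1 * (v^-1 * l))%g = 1%g.
    apply: (coset_descends_uniq hW _ Dzu); last by rewrite mulgA mulgK.
    by apply: parabolicM; [exact: parabolicV|apply: parabolicM => //;
      exact: parabolicV].
  by move=> /mulg1_eq; rewrite invgK => ->; rewrite invgM invgK mulgA mulgV mul1g.
rewrite (big_morph Posz PoszD erefl); apply: eq_big_seq => v;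
  rewrite memJ => /asboolP Jv.
(* For fixed [v], right translation by [l^-1 v] is a bijection from the elements descending under
   [J] to those with [Q v], and it changes the length by [len v - len l]. *)
congr (_%:Z); rewrite -!size_filter.
rewrite -(size_map (fun w => w * (l^-1 * v))%g [seq w <- sphere (len v) n | descends
  s J w]).
have lvK w : (w * (l^-1 * v) * (v^-1 * l))%g = w by rewrite !mulgA mulgK mulgVK.
have vlK w : (w * (v^-1 * l) * (l^-1 * v))%g = w by rewrite !mulgA mulgK mulgVK.
have Jy : parabolic s J (l^-1 * v)%g by apply: parabolicM => //; exact: parabolicV.
have len_y w : descends s J w -> (len (w * (l^-1 * v))%g + len l = len w + len v)%N.
  move=> /descendsP Dw; rewrite -(len_descents hW Dw Jy) -(lenJ v Jv).
  by rewrite [(len v + _)%N]addnC addnA.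
apply: perm_size; apply: uniq_perm.
- by rewrite filter_uniq ?fset_uniq.
- by rewrite map_inj_uniq ?filter_uniq ?fset_uniq //; exact: mulIg.
move=> z; rewrite mem_filter mem_sphere; apply/andP/mapP => [[Dz /eqP zn]|[w]].
  exists (z * (v^-1 * l))%g; last by rewrite vlK.
  by rewrite mem_filter mem_sphere [descends _ _ _]Dz -(len_y _ Dz) vlK zn eqxx.
rewrite mem_filter mem_sphere => /andP[Dw /eqP wn] ->.
by rewrite /Q lvK Dw len_y // wn.
Qed.

Lemma countZ_sum (P : pred W) (r : seq W) :
  (count P r)%:Z = \sum_(w <- r) (P w)%:R.
Proof.
by elim: r => [|w r IHr]; rewrite ?big_nil ?big_cons //= PoszD IHr natz.
Qed.

(** After exchanging the sums, [J] runs over the subsets of the descent set of a fixed [w], all of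
    them spherical. The alternating sum vanishes unless this set is empty, that is, unless
    [w = 1]. *)
Lemma alternating_sphere_count :
  \sum_(J : {set S} | `[< spherical s J >])
    (-1) ^+ #|J| * sphere_count (descends s J) = 1 :> fps int.
Proof.
apply/funext => n; rewrite fps_sumE big_mkcond /=.
transitivity (\sum_(w <- sphere 0 n) (w == 1%g)%:R : int).
  transitivity (\sum_(J : {set S}) \sum_(w <- sphere 0 n) (-1) ^+ #|J| * (descends s
    J w)%:R : int).
    apply: eq_bigr => J _; rewrite fps_signE /sphere_count countZ_sum -mulr_sumr.
    case: asboolP => // nsphJ; rewrite big1 ?mulr0 // => w _.
    by case E: (descends s J w) => //; case: nsphJ; exact: (descends_spherical hW E).
  rewrite exchange_big; apply: eq_bigr => w _ /=.
  transitivity (\sum_(J : {set S} | J \subset descents s [set: S]%SET w) (-1) ^+ #|J|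
    : int).
    rewrite [RHS]big_mkcond; apply: eq_bigr => J _.
    rewrite (descendsE s w (finset.subsetT J)).
    by case: (_ \subset _); rewrite ?mulr1 ?mulr0.
  rewrite alternating_sum_subsets; congr (nat_of_bool _)%:R.
  apply/eqP/eqP => [/(descents_eq0 hW (parabolicT hW w))//|->].
  by apply/setP => i; rewrite !inE mul1g len1 ltn0.
rewrite [RHS]coef1 -(countZ_sum (pred1 1%g)) count_uniq_mem ?fset_uniq //.
by rewrite mem_sphere len1 eq_sym; case: (n == 0)%N.
Qed.

Definition spherical_seq : seq {set S} := [seq J <- enum {set S} | `[< spherical s J
  >]].

Lemma mem_spherical_seq J : (J \in spherical_seq) = `[< spherical s J >].
Proof. by rewrite mem_filter mem_enum andbT. Qed.

(** Common denominator of the fractions [1 / p_J]; the cofactor of [p_J] is [spherical_coprod J]. *)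
Definition spherical_prod : {poly int} := \prod_(J <- spherical_seq) poincare_poly s
  J.

Definition spherical_coprod (J : {set S}) : {poly int} :=
  \prod_(K <- spherical_seq | K != J) poincare_poly s K.

Lemma spherical_prodE (J : {set S}) : spherical s J ->
  spherical_prod = poincare_poly s J * spherical_coprod J.
Proof.
move=> sphJ; rewrite /spherical_prod (bigD1_seq J) //=.
  by rewrite mem_spherical_seq; apply/asboolP.
by rewrite filter_uniq ?enum_uniq.
Qed.

(** By [poincare_coset], [p_W t^N_J / p_J] is the length series of the elements descending under
    [J], and the alternating sum of these series is [1]. The witnesses are the fractions
    [t^N_J / p_J] brought to the common denominator. *)
Lemma poincare_inverse_sum (R : comNzRingType) (q : R) :
  (forall J : {set S}, spherical s J -> invertible (eval_int q (poincare_poly s J)))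
    ->
  poincare_inverse_at s q (\sum_(J : {set S}) (-1) ^+ #|J| * euler_term s q J).
Proof.
move=> hq.
exists (\sum_(J : {set S} | `[< spherical s J >])
  (-1) ^+ #|J| * ('X^(len (longest s J)) * spherical_coprod J)), spherical_prod;
    split.
- exists spherical_seq; split=> // J; rewrite mem_spherical_seq; exact: asboolW.
- rewrite raddf_sum mulr_sumr -[RHS]mul1r -alternating_sphere_count mulr_suml.
  apply: eq_bigr => J /asboolP sphJ.
  apply: etrans (congr1 ( *%R _) (fps_of_poly_signM _ _)) _.
  rewrite mulrCA -mulrA; congr (_ * _).
  by rewrite (spherical_prodE sphJ) !fps_of_polyM !mulrA poincare_coset.
- rewrite /eval_int rmorph_sum horner_sum [in RHS]big_mkcond mulr_suml;
  apply: eq_bigr => J _.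
  rewrite /euler_term; case: asboolP => [sphJ|_]; last by rewrite mulr0 mul0r.
  have := poincare_invP (I := [set: S]%SET) (fun J _ => hq J) (finset.subsetT J) sphJ.
  rewrite /eval_int (spherical_prodE sphJ) !rmorphM !rmorphXn rmorphN1 !hornerE /= =>
    E.
  rewrite map_polyX hornerX -[_ * poincare_inv _ _ _ * _]mulrA.
  by rewrite [poincare_inv _ _ _ * _]mulrC E mulr1.
Qed.

End Poincare.

(** * Parabolic subalgebras *)

Section HeckeAlgebra.
Variables (W : groupType) (S : finType) (m : S -> S -> option nat) (s : S -> W).
Hypothesis hW : coxeter_system m s.

Lemma parabolic_setT : parabolic s [set: S]%SET = [set: W].
Proof. by apply/seteqP; split=> // w _; exact: (parabolicT hW). Qed.

Variables (R : comNzRingType) (q : R) (H : algType R) (T : W -> H).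
Hypothesis hH : is_hecke_algebra s q T.

Lemma hecke_parabolicT : parabolic_hecke s q [set: S]%SET T.
Proof.
split; [|exact: (hecke_one hH)|by move=> i w _ _; exact: (hecke_up hH)
  |by move=> i w _ _; exact: (hecke_down hH)].
rewrite parabolic_setT; apply: free_basis_fam; last exact: (hecke_basis hH).
by move=> x y _ _; exact: (hecke_inj hH).
Qed.

Let hT := hecke_parabolicT.

Variable I : {set S}.
Local Notation WI := (parabolic s I).
Local Notation gens := [set T (s i) | i in [set i | i \in I]].

Lemma hecke_span_simple i a : i \in I -> fam_span WI T a -> fam_span WI T (T (s i) *
  a).
Proof.
move=> iI [r [rI ->]]; rewrite mulr_sumr big_seq.
elim/big_ind: _ => [||[c w] ur]; [exact: fam_span0|exact: fam_spanD|].
rewrite /= -scalerAr; have Iw : WI w := rI _ ur.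
have Isw : WI (s i * w)%g by apply: parabolicM => //; exact: parabolic_simple.
have [lt_w|] := boolP (len s w < len s (s i * w)%g)%N.
  by rewrite (hecke_up hH) //; exact: fam_spanZ.
have lenE x : len s (s i * x)%g = len s (x^-1 * s i)%g.
  by rewrite -(lenV hW) invgM (simpleV hW).
rewrite lenE -(lenV hW w) (len_simple_ltn hW) negbK -lenE (lenV hW) => lt_sw.
by rewrite (hecke_down hH) // scalerDr !scalerA; apply: fam_spanD; exact: fam_spanZ.
Qed.

Lemma hecke_span_closed : GRing.subalg_closed [pred a | `[< fam_span WI T a >]].
Proof.
split=> [|c a b /asboolP Ia /asboolP Ib|a b /asboolP[r [rI ->]] /asboolP Ib];
  apply/asboolP.
- by rewrite -(hecke_one hH) -[T _]scale1r; apply: fam_spanZ; exact: (parabolic1 hW).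
- apply: fam_spanD => //; case: Ia => r [rI ->]; rewrite scaler_sumr.
  by apply: fam_span_sum => u /rI; rewrite scalerA; exact: fam_spanZ.
rewrite mulr_suml; apply: fam_span_sum => u /rI Iu; rewrite -scalerAl.
suff : fam_span WI T (T u.2 * b).
  case=> r' [r'I ->]; rewrite scaler_sumr.
  by apply: fam_span_sum => v /r'I; rewrite scalerA; exact: fam_spanZ.
have [v [vI _ ->]] := parabolic_hecke_prod hW hT (finset.subsetT I) Iu.
elim: v vI => [|i v IHv] vI; first by rewrite big_nil mul1r.
rewrite big_cons -mulrA; apply: hecke_span_simple; first by apply: vI;
  rewrite mem_head.
by apply: IHv => j jv; apply: vI; rewrite inE jv orbT.
Qed.

(** The span of the [T w] with [w] in [W_I] is a subalgebra containing the generators of [H_I]. *)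
Lemma hecke_parabolic_span (x : hecke_parabolic s T I) : fam_span WI T (val x).
Proof.
case: x => x /= /asboolP/(_ _ hecke_span_closed) H1; apply/asboolP; apply: H1.
move=> _ [i /= iI <-]; apply/asboolP; rewrite -[T _]scale1r; apply: fam_spanZ.
exact: parabolic_simple.
Qed.

Lemma T_generated w : WI w -> T w \in generated_subalgebra gens.
Proof.
move=> /(parabolic_hecke_prod hW hT (finset.subsetT I))[u [uI _ ->]].
elim: u uI => [|i u IHu] uI; first by rewrite big_nil rpred1.
rewrite big_cons rpredM ?IHu //.
  apply/asboolP => K _; apply; exists i => //=; apply: uI; exact: mem_head.
by move=> j ju; apply: uI; rewrite inE ju orbT.
Qed.

(* The value outside [W_I] is junk. *)
Definition T_parabolic (w : W) : hecke_parabolic s T I := insubd (0 : hecke_parabolic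
  s T I) (T w).

Lemma val_T_parabolic w : WI w -> val (T_parabolic w) = T w.
Proof. by move=> Iw; rewrite val_insubd T_generated. Qed.

Lemma hecke_valZ (c : R) (x : hecke_parabolic s T I) : val (c *: x) = c *: (val x :
  H).
Proof. by []. Qed.

Lemma hecke_valM (x y : hecke_parabolic s T I) : val (x * y) = val x * val y :> H.
Proof. exact: (rmorphM (val : subalgebra gens -> H)). Qed.

Lemma hecke_valD (x y : hecke_parabolic s T I) : val (x + y) = val x + val y :> H.
Proof. exact: (raddfD (val : subalgebra gens -> H)). Qed.

Lemma hecke_val_sum (K : Type) (r : seq K) (F : K -> hecke_parabolic s T I) :
  val (\sum_(k <- r) F k) = \sum_(k <- r) (val (F k) : H).
Proof. exact: (raddf_sum (val : subalgebra gens -> H)). Qed.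

Lemma parabolic_hecke_sub : parabolic_hecke s q I T_parabolic.
Proof.
have vsum (r : seq (R * W)) : (forall u, u \in r -> WI u.2) ->
    val (\sum_(u <- r) u.1 *: T_parabolic u.2) = \sum_(u <- r) u.1 *: T u.2.
  move=> rI; rewrite hecke_val_sum; apply: eq_big_seq => u /rI Iu.
  by rewrite hecke_valZ val_T_parabolic.
have [_ Tfree] := ph_basis hT; rewrite parabolic_setT in Tfree.
split=> [||i w iI Iw lt_w|i w iI Iw lt_w].
- split=> [x|r c ur rI c0].
    have [r [rI xE]] := hecke_parabolic_span x.
    by exists r; split=> //; apply: val_inj; rewrite vsum.
  apply: Tfree => //; move: (congr1 val c0); rewrite hecke_val_sum => c0';
    rewrite -[RHS](raddf0 (val : subalgebra gens -> H)) -[RHS]c0'.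
  by apply: eq_big_seq => w /rI Iw; rewrite hecke_valZ val_T_parabolic.
- by apply: val_inj; rewrite val_T_parabolic ?(hecke_one hH) ?rmorph1 //;
  exact: (parabolic1 hW).
- have Isw : WI (s i * w)%g by apply: parabolicM => //; exact: parabolic_simple.
  apply: val_inj; rewrite hecke_valM !val_T_parabolic //;
    last exact: parabolic_simple.
  exact: (hecke_up hH).
- have Isw : WI (s i * w)%g by apply: parabolicM => //; exact: parabolic_simple.
  apply: val_inj; rewrite hecke_valM hecke_valD !hecke_valZ !val_T_parabolic //;
    last exact: parabolic_simple.
  exact: (hecke_down hH).
Qed.

(** If [T w] lies in [H_I], its coefficient at [w] in an expansion over [W_I] is [1], which forces
    [w] into [W_I]. *)
Lemma hecke_parabolic_basisE : hecke_parabolic_basis s T I = T_parabolic @` WI.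
Proof.
apply/seteqP; split=> [x [w _ xE]|_ [w Iw <-]]; last by exists w => //;
  rewrite val_T_parabolic.
suff Iw : WI w by exists w => //; apply: val_inj; rewrite val_T_parabolic.
have [r [rI]] := hecke_parabolic_span x; rewrite -xE => /(congr1 (fun a => coef hT w
  a : R)).
rewrite coefT ?eqxx; last exact: (parabolicT hW).
rewrite linear_sum; apply: contraPP => nIw; rewrite big_seq big1.
  by move=> /eqP; rewrite oner_eq0.
move=> u /rI Iu; rewrite linearZ /= coefT; last exact: (parabolicT hW).
case: eqP => [E|_]; last exact: mulr0.
by case: nIw; rewrite -E.
Qed.

End HeckeAlgebra.

(** * The full Hecke algebra, the recursion, and integral power series *)

Theorem theorem5p4 (W : groupType) (S : finType) (m : S -> S -> option nat)
    (s : S -> W) (hW : coxeter_system m s) :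
  (forall (R : comNzRingType) (q : R)
      (hq : forall I : {set S}, spherical s I ->
        invertible (eval_int q (poincare_poly s I)))
      (H : algType R) (T : W -> H) (hH : is_hecke_algebra s q T)
      (eps : {lrmorphism H -> R | *%R}) (heps : is_index_rep s q T eps),
    [/\ is_euler_algebra (range T) eps,
        poincare_inverse_at s q (euler_char (range T) eps)
      & infinite_set [set: W] ->
        (forall I : {set S}, I \proper [set: S]%SET ->
          is_euler_algebra (hecke_parabolic_basis s T I)
            (hecke_parabolic_rep s T eps I)) /\
        euler_char (range T) eps =
          \sum_(I : {set S} | I \proper [set: S]%SET)
            (-1) ^+ (#|~: I|%SET - 1) *
            euler_char (hecke_parabolic_basis s T I)
              (hecke_parabolic_rep s T eps I)]) /\
  (forall (H : algType (fps int)) (T : W -> H)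
      (hH : is_hecke_algebra s (fpsX int) T)
      (eps : {lrmorphism H -> fps int | *%R})
      (heps : is_index_rep s (fpsX int) T eps),
    is_euler_algebra (range T) eps /\
    euler_char (range T) eps * poincare_series s [set: W] = 1).
Proof.
(* The full algebra is the parabolic case [I = S]; both halves of the statement rest on this closed
   formula. *)
have main (R : comNzRingType) (q : R)
      (hq : forall I : {set S}, spherical s I ->
        invertible (eval_int q (poincare_poly s I)))
      (H : algType R) (T : W -> H) (hH : is_hecke_algebra s q T)
      (eps : {lrmorphism H -> R | *%R}) (heps : is_index_rep s q T eps) :
    is_euler_algebra (range T) eps /\
    euler_char (range T) eps = \sum_(J : {set S}) (-1) ^+ #|J| * euler_term s q J.
  have hT := hecke_parabolicT hW hH; rewrite -(parabolic_setT hW).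
  split; first exact: (parabolic_is_euler hW hT (fun J _ => hq J) (fun w _ => heps
    w)).
  rewrite (parabolic_euler_char hW hT (fun J _ => hq J) (fun w _ => heps w)).
  by apply: eq_bigl => J; rewrite finset.subsetT.
split=> [R q hq H T hH eps heps|H T hH eps heps].
  have [eulerH chiH] := main R q hq H T hH eps heps; split=> //.
    by rewrite chiH; apply: (poincare_inverse_sum hW hq).
  move=> infW.
  have epsI (I : {set S}) w : parabolic s I w ->
      hecke_parabolic_rep s T eps I (T_parabolic s T I w) = q ^+ len s w.
    by move=> Iw; rewrite -heps -(val_T_parabolic hW hH Iw).
  have hTI I := parabolic_hecke_sub hW hH I.
  split=> [I _|].
    rewrite (hecke_parabolic_basisE hW hH).
    exact: (parabolic_is_euler hW (hTI I) (fun J _ => hq J) (epsI I)).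
  (* Inclusion-exclusion is applied to the signed terms [euler_term]; the one for [J = S] is zero
     because [W] is infinite. *)
  rewrite chiH -proper_inclusion_exclusion => [|].
    apply: eq_bigr => I _; congr (_ * _); rewrite (hecke_parabolic_basisE hW hH).
    by rewrite (parabolic_euler_char hW (hTI I) (fun J _ => hq J) (epsI I)).
  rewrite /euler_term; case: asboolP => [|_]; last exact: mulr0.
  by rewrite /spherical (parabolic_setT hW) => /infW.
(* The constant coefficient of [p_I] is [1], the identity being the only element of length zero. *)
have hq (I : {set S}) : spherical s I ->
    invertible (eval_int (fpsX int) (poincare_poly s I)).
  move=> sphI; rewrite eval_int_fpsX; apply: fps_invertible.
  rewrite /fps_of_poly /poincare_poly coef_sum (bigD1_seq 1%g) ?fset_uniq //=;
    last first.
    by rewrite in_fset_set // inE; exact: (parabolic1 hW).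
  rewrite len1 coefXn eqxx big1 ?addr0 // => w w1; rewrite coefXn.
  by case: eqP => // E; case/eqP: w1; apply: (len_eq0 hW).
have [eulerH chiH] := main _ _ hq H T hH eps heps; split=> //.
(* With [chi d = n], [p n = d] and [d y = 1], one gets [chi p = chi p d y = n p y = d y = 1]. *)
have [n [d [sd Pn rd]]] := poincare_inverse_sum hW hq;
  rewrite -chiH !eval_int_fpsX in rd.
have [y dy] := spherical_denominator_invertible hq sd; rewrite eval_int_fpsX in dy.
by rewrite -[LHS]mulr1 -dy mulrA [X in X * _]mulrAC rd [X in X * _]mulrC Pn.
Qed.
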